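(* Let $V=V_{\bar 0}\oplus V_{\bar 1}$ be a complex vector superspace with $\dim V\le 7$. Consider the supersymmetric bilinear forms $(\cdot|\cdot)$ on $V$ that are inhomogeneous, irreducible, and whose restrictions to $V_{\bar 0}$ and to $V_{\bar 1}$ are nondegenerate. Every such form is equivalent to a form whose Gram matrix, in a homogeneous basis with the $k=\dim V_{\bar 0}$ even vectors first and then the $2\ell=\dim V_{\bar 1}$ odd vectors, is $$G=\begin{pmatrix} I_k & B\\ B^T & J_{2\ell}\end{pmatrix}$$ with $(\dim V_{\bar 0},\dim V_{\bar 1},B)$ one of the following: - $(1,2)$: $B=\mathrm{B}_1=\begin{pmatrix}1&0\end{pmatrix}$; - $(2,2)$: $B=\mathrm{B}_{2,\alpha}=\begin{pmatrix}1&0\\0&\alpha\end{pmatrix}$ with $\alpha\in\mathbb{C}^+$, or $B=\mathrm{B}_3=\begin{pmatrix}1&0\\ i&0\end{pmatrix}$; - $(3,2)$: $B=\mathrm{B}_4=\begin{pmatrix}1&0\\0&1\\0&i\end{pmatrix}$; - $(3,4)$: $B=\mathrm{B}_5=\begin{pmatrix}1&0&0&0\\0&1&1&0\\0&0&0&i\end{pmatrix}$; - $(4,2)$: $B=\mathrm{B}_6=\begin{pmatrix}1&0\\ i&0\\0&1\\0&i\end{pmatrix}$. Moreover, each of these forms is irreducible, inhomogeneous, with nondegenerate restrictions to $V_{\bar 0}$ and $V_{\bar 1}$, and any two distinct entries of this list (including $\mathrm{B}_{2,\alpha}$ for distinct $\alpha\in\mathbb{C}^+$) give inequivalent forms. In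 particular no such form exists for other values of $(\dim V_{\bar 0},\dim V_{\bar 1})$ with $\dim V\le 7$.
   Context: A bilinear form $(\cdot|\cdot)\colon V\times V\to\mathbb{C}$ on a superspace is supersymmetric if $(a|b)=(-1)^{p(a)p(b)}(b|a)$ for all homogeneous $a,b$ of parities $p(a),p(b)$. It is inhomogeneous if $(V_{\bar 0}|V_{\bar 1})\neq 0$ and $(V_j|V_j)\neq 0$ for some $j\in\{\bar 0,\bar 1\}$. It is reducible if $V=U\oplus W$ with $U,W$ nonzero subsuperspaces and $(U|W)=0$; otherwise irreducible. Two forms $(\cdot|\cdot)_1,(\cdot|\cdot)_2$ on $V$ are equivalent if there is an even (parity-preserving) linear automorphism $\varphi$ of $V$ with $(\varphi u|\varphi v)_1=(u|v)_2$ for all $u,v\in V$. $J_{2\ell}=\mathrm{diag}(J,\dots,J)$ ($\ell$ blocks), $J=\begin{pmatrix}0&1\\-1&0\end{pmatrix}$, $i=\sqrt{-1}$, and $\mathbb{C}^+=\{\gamma\in\mathbb{C}:\operatorname{Re}\gamma>0,\text{ or }\operatorname{Re}\gamma=0\text{ and }\operatorname{Im}\gamma>0\}$. *)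

(* Defs.v *)
From HB Require Import structures.
From mathcomp Require Import all_boot all_order all_algebra.
From mathcomp Require Import reals.
From mathcomp Require Import complex.
Set Implicit Arguments. Unset Strict Implicit. Unset Printing Implicit Defensive.
Import Order.TTheory GRing.Theory Num.Theory.
Local Open Scope ring_scope.

Section SuperForms.
Variable R : realType.
Local Notation C := R[i].

(* A bilinear form on V = V_0 (+) V_1 with V_0 = C^k, V_1 = C^m, given by its
   Gram matrix G in a homogeneous basis (even vectors first); with row vectors,
   (u|v) = u *m G *m v^T. *)

(* supersymmetric: (a|b) = (-1)^{p(a)p(b)} (b|a) *)
Definition supersym k m (G : 'M[C]_(k + m)) : Prop :=
  [/\ (ulsubmx G)^T = ulsubmx G,
      (drsubmx G)^T = - drsubmx G &
      dlsubmx G = (ursubmx G)^T].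

Definition inhomogeneous k m (G : 'M[C]_(k + m)) : Prop :=
  ursubmx G != 0 /\ (ulsubmx G != 0 \/ drsubmx G != 0).

Definition nondeg_restrictions k m (G : 'M[C]_(k + m)) : Prop :=
  \det (ulsubmx G) != 0 /\ \det (drsubmx G) != 0.

(* The subsuperspace U = U0 (+) U1 (U0 = row space of U0 in C^k, U1 = row space
   of U1 in C^m), represented as the row space of a block-diagonal matrix. *)
Definition sspace k m (U0 : 'M[C]_k) (U1 : 'M[C]_m) : 'M[C]_(k + m) :=
  block_mx U0 0 0 U1.

Definition reducible k m (G : 'M[C]_(k + m)) : Prop :=
  exists (U0 W0 : 'M[C]_k) (U1 W1 : 'M[C]_m),
    [/\ (U0 :&: W0 == (0 : 'M[C]_k))%MS && (U0 + W0 == (1%:M : 'M[C]_k))%MS,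
        (U1 :&: W1 == (0 : 'M[C]_m))%MS && (U1 + W1 == (1%:M : 'M[C]_m))%MS,
        (U0 != 0) || (U1 != 0),
        (W0 != 0) || (W1 != 0) &
        sspace U0 U1 *m G *m (sspace W0 W1)^T = 0].

Definition irreducible k m (G : 'M[C]_(k + m)) : Prop := ~ reducible G.

(* equivalence: an even automorphism phi (u |-> u *m diag(P,Q)) with
   (phi u | phi v)_1 = (u | v)_2 *)
Definition sequiv k m (G1 G2 : 'M[C]_(k + m)) : Prop :=
  exists (P : 'M[C]_k) (Q : 'M[C]_m),
    [/\ P \in unitmx, Q \in unitmx &
        G2 = sspace P Q *m G1 *m (sspace P Q)^T].

Definition admissible k m (G : 'M[C]_(k + m)) : Prop :=
  [/\ supersym G, inhomogeneous G, irreducible G & nondeg_restrictions G].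

(* J_{2l} = diag(J, ..., J), J = [[0,1],[-1,0]] *)
Definition Jmx m : 'M[C]_m :=
  \matrix_(i < m, j < m)
    (if ~~ odd i && (j == i.+1 :> nat) then 1
     else if odd i && (i == j.+1 :> nat) then -1 else 0).

Definition canon k m (B : 'M[C]_(k, m)) : 'M[C]_(k + m) :=
  block_mx 1%:M B B^T (Jmx m).

Definition mx_of k m (s : seq (seq C)) : 'M[C]_(k, m) :=
  \matrix_(i < k, j < m) nth 0 (nth [::] s i) j.

Definition Cplus (a : C) : Prop :=
  0 < complex.Re a \/ (complex.Re a = 0 /\ 0 < complex.Im a).

Local Notation iC := (Complex (0 : R) 1).

Definition listed k m (B : 'M[C]_(k, m)) : Prop :=
  [/\ k = 1%N, m = 2%N & B = mx_of k m [:: [:: 1; 0]]] \/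
  [/\ k = 2%N, m = 2%N &
      (exists2 a, Cplus a & B = mx_of k m [:: [:: 1; 0]; [:: 0; a]])] \/
  [/\ k = 2%N, m = 2%N & B = mx_of k m [:: [:: 1; 0]; [:: iC; 0]]] \/
  [/\ k = 3%N, m = 2%N & B = mx_of k m [:: [:: 1; 0]; [:: 0; 1]; [:: 0; iC]]] \/
  [/\ k = 3%N, m = 4%N &
      B = mx_of k m [:: [:: 1; 0; 0; 0]; [:: 0; 1; 1; 0]; [:: 0; 0; 0; iC]]] \/
  [/\ k = 4%N, m = 2%N &
      B = mx_of k m [:: [:: 1; 0]; [:: iC; 0]; [:: 0; 1]; [:: 0; iC]]].

End SuperForms.

(* Main.v *)
Require Import Defs.
From HB Require Import structures.
From mathcomp Require Import all_boot all_order all_algebra.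
From mathcomp Require Import reals.
From mathcomp Require Import complex.
From mathcomp Require Import ring zify.
Import Order.TTheory GRing.Theory Num.Theory.
Local Open Scope ring_scope.
Set Implicit Arguments. Unset Strict Implicit. Unset Printing Implicit Defensive.

(* By Witt's theorem the restrictions to the even and odd parts can be taken to
   be I_k and J_m, so that forms up to equivalence become k x m blocks B up to
   O(k) x Sp(m), and a decomposition of the form becomes a pair of idempotents
   E0 = E0^T, E1 J = J E1^T with E0 B = B E1^T.

   If the form is irreducible then {u | u B = 0} and {w | B w^T = 0} are totally
   isotropic (a non-isotropic vector, resp. a hyperbolic plane, would split
   off), so k <= 2r and m <= 2r with r = rank B. Moreover a non-isotropic u in
   the column space of B with u B J B^T = 0 would split off together with a
   plane of the odd part; this rules out m = 2r > k > 1. For k + m <= 7 only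
   (k, m, r) = (1,2,1), (2,2,1), (2,2,2), (3,2,2), (4,2,2), (3,4,3) remain, and
   in each of them Witt's theorem, applied to the rows or columns of B, identifies
   B through its Gram matrices B^T B and B J B^T. *)

(** * Witt's extension theorem *)

Section Witt.
Variable F : numClosedFieldType.

Lemma trmx11 (M : 'M[F]_1) : M^T = M.
Proof. by rewrite [M]mx11_scalar tr_scalar_mx. Qed.

(** By polarization: if the diagonal entries at [i] and [j] vanish, [e i + e j] has value
    [2 * M i j]. *)
Lemma sym_anisotropic n (M : 'M[F]_n) :
  M^T = M -> M != 0 -> exists x : 'rV_n, x *m M *m x^T != 0.
Proof.
move=> symM /matrix0Pn[i [j Mij]].
pose e i : 'rV[F]_n := delta_mx 0 i.
have eMe k l : e k *m M *m (e l)^T = (M k l)%:M.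
  rewrite -rowE trmx_delta -colE; apply/matrixP => a c.
  by rewrite !ord1 !mxE eqxx mulr1n.
have nz (a : F) : a != 0 -> (a%:M : 'M[F]_1) != 0.
  by apply: contraNneq => /matrixP/(_ 0 0); rewrite !mxE mulr1n => ->.
have [Mi|Mi] := eqVneq (M i i) 0; last by exists (e i); rewrite eMe nz.
have [Mj|Mj] := eqVneq (M j j) 0; last by exists (e j); rewrite eMe nz.
exists (e i + e j); rewrite linearD /= !mulmxDl !mulmxDr !eMe Mi Mj.
rewrite -(_ : M i j = M j i); last by rewrite -{1}symM mxE.
by rewrite !raddf0 add0r addr0 -raddfD /= nz // -mulr2n mulrn_eq0.
Qed.

Lemma alternating_self n (S : 'M[F]_n) (x : 'rV_n) :
  S^T = - S -> x *m S *m x^T = 0.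
Proof.
move=> altS; have: (x *m S *m x^T)^T = - (x *m S *m x^T).
  by rewrite !trmx_mul trmxK altS mulNmx mulmxN mulmxA.
rewrite trmx11 => /eqP; rewrite -addr_eq0 -mulr2n -scaler_nat scaler_eq0.
by rewrite pnatr_eq0 /= => /eqP.
Qed.

Lemma row_free_ker0 m n (A : 'M[F]_(m, n)) :
  (forall x : 'rV_m, x *m A = 0 -> x = 0) -> row_free A.
Proof.
by move=> kerA; rewrite -kermx_eq0; apply/rowV0P => v /sub_kermxP/kerA.
Qed.

Lemma row_free_inj0 m n (A : 'M[F]_(m, n)) p (x : 'M_(p, m)) :
  row_free A -> x *m A = 0 -> x = 0.
Proof. by move=> fA /eqP; rewrite mulmx_free_eq0 // => /eqP. Qed.

Lemma mx11_neq0 (M : 'M[F]_1) : M != 0 -> M 0 0 != 0.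
Proof. by apply: contraNneq => M0; rewrite [M]mx11_scalar M0 raddf0. Qed.

(* The prescribed products of the new vector [v] depend only on the Gram matrix
   [N] of [X], so that two systems with the same Gram matrix can be extended in
   parallel. *)
Lemma gram_extension (b : bool) r (N : 'M[F]_r) :
  exists (c : 'cV[F]_r) (d : F),
    forall n (S : 'M[F]_n) (X : 'M[F]_(r, n)),
      (r < n)%N -> S \in unitmx -> S^T = (-1) ^+ b *: S ->
      X *m S *m X^T = N -> row_free X ->
      exists v : 'rV[F]_n,
        [/\ X *m S *m v^T = c, v *m S *m v^T = d%:M & row_free (col_mx X v)].
Proof.
have [uN|nuN] := boolP (N \in unitmx).
  (* For invertible [N] the new vector is taken orthogonal to [X], of square 1 in the symmetric case
     and 0 in the skew case. *)
  exists 0, (~~ b)%:R => n S X ltrn uS trS XSX fX.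
  (* [p] projects onto the orthogonal complement of the rows of [X]. *)
  pose p := 1%:M - S *m X^T *m invmx N *m X.
  have pX0 : p *m (S *m X^T) = 0.
    by rewrite mulmxBl mul1mx -!mulmxA [X *m (_ *m _)]mulmxA XSX mulVmx // mulmx1 subrr.
  have sX : X *m S = (-1) ^+ b *: (S *m X^T)^T.
    by rewrite trmx_mul trmxK trS -scalemxAr scalerA -expr2 sqrr_sign scale1r.
  have perp (v : 'rV_n) : v *m (S *m X^T) = 0 -> X *m S *m v^T = 0.
    by move=> v0; rewrite sX -scalemxAl -trmx_mul v0 trmx0 scaler0.
  have freev (v : 'rV_n) : v *m (S *m X^T) = 0 -> v != 0 -> row_free (col_mx X v).
    move=> v0 vn0; apply: row_free_ker0 => x.
    rewrite -[x]hsubmxK mul_row_col => x0.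
    have /(congr1 (mulmx^~ (S *m X^T))) := x0.
    rewrite mul0mx mulmxDl -[_ *m v *m _]mulmxA v0 mulmx0 addr0.
    rewrite -mulmxA [X *m _]mulmxA XSX => /row_free_inj0 l0.
    move: x0; rewrite l0 ?row_free_unit // mul0mx add0r.
    rewrite [rsubmx x]mx11_scalar mul_scalar_mx => /eqP.
    by rewrite scaler_eq0 (negPf vn0) orbF => /eqP ->; rewrite raddf0 row_mx0.
  have [v vn0 v0] : exists2 v : 'rV_n, v != 0 & v *m (S *m X^T) = 0.
    have : kermx (S *m X^T) != 0.
      rewrite kermx_eq0 -row_leq_rank -ltnNge.
      by apply: leq_ltn_trans (rank_leq_col _) ltrn.
    by case/rowV0Pn=> v /sub_kermxP v0 vn0; exists v.
  case: b trS sX perp => trS sX perp.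
    exists v; split; [exact: perp | | exact: freev].
    by rewrite alternating_self ?raddf0 // trS expr1 scaleN1r.
  rewrite expr0 scale1r in trS.
  (* The form restricted to this complement is nonzero, because [S] is invertible and [v] lies
     there. So it has a non-isotropic vector, which a square root normalises. *)
  have [||x xn0] := @sym_anisotropic n (p *m S *m p^T).
  - by rewrite !trmx_mul trmxK trS mulmxA.
  - apply: contraNneq vn0 => pSp0.
    have vSp : v *m S *m p^T = v *m S.
      rewrite linearB /= trmx1 mulmxBr mulmx1 !trmx_mul !trmxK.
      by rewrite !mulmxA -[v *m _ *m _]mulmxA v0 !mul0mx subr0.
    have vp : v *m p = v.
      by rewrite mulmxBr mulmx1 !mulmxA -[v *m _ *m _]mulmxA v0 !mul0mx subr0.
    have : v *m S = 0 by rewrite -vSp -{1}vp -!mulmxA [p *m _]mulmxA pSp0 mulmx0.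
    by move/(row_free_inj0 _) => ->; rewrite ?row_free_unit.
  pose q := (x *m (p *m S *m p^T) *m x^T) 0 0.
  have qn0 : q != 0 by exact: mx11_neq0.
  have xp0 : x *m p *m (S *m X^T) = 0 by rewrite -mulmxA pX0 mulmx0.
  exists ((sqrtC q)^-1 *: (x *m p)); split.
  - by apply: perp; rewrite -scalemxAl xp0 scaler0.
  - rewrite -!scalemxAl linearZ -scalemxAr /= scalerA -expr2 exprVn sqrtCK.
    have -> : x *m p *m S *m (x *m p)^T = q%:M.
      by rewrite -mx11_scalar trmx_mul !mulmxA.
    by rewrite scale_scalar_mx mulVf.
  - apply: freev; first by rewrite -scalemxAl xp0 scaler0.
    rewrite scaler_eq0 invr_eq0 sqrtC_eq0 (negPf qn0) /=.
    by apply: contraNneq xn0 => xp; rewrite !mulmxA xp !mul0mx.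
have [z zn0 zN] : exists2 z : 'rV_r, z != 0 & z *m N = 0.
  move: nuN; rewrite -row_free_unit -kermx_eq0.
  by case/rowV0Pn=> z /sub_kermxP zN zn0; exists z.
have [j zj] : exists j, z 0 j != 0.
  by case/matrix0Pn: zn0 => i [j]; rewrite ord1; exists j.
(* For singular [N] the new vector is isotropic and pairs with the radical vector [z *m X] to
   [z 0 j], up to sign; this nonzero pairing forces independence. *)
exists (delta_mx j 0), 0 => n S X ltrn uS trS XSX fX.
have zc : z *m delta_mx j 0 = (z 0 j)%:M :> 'M_1.
  by rewrite -colE; apply/matrixP => a l; rewrite !ord1 !mxE eqxx mulr1n.
have fXS : row_free (X *m S).
  by rewrite /row_free mxrankMfree // row_free_unit.
have trN : N^T = (-1) ^+ b *: N.
  by rewrite -XSX !trmx_mul trmxK trS -scalemxAl -scalemxAr mulmxA.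
have Nz : N *m z^T = 0.
  apply: trmx_inj; rewrite trmx_mul trmxK trN -scalemxAr zN scaler0.
  by rewrite trmx0.
pose v0 : 'rV_n := (pinvmx (X *m S) *m delta_mx j 0)^T.
have XSv0 : X *m S *m v0^T = delta_mx j 0 by rewrite trmxK mulmxA mulmxVp ?mul1mx.
have [v XSv vSv] : exists2 v : 'rV_n, X *m S *m v^T = delta_mx j 0 & v *m S *m v^T = 0.
  case: b trS trN => trS trN.
    by exists v0; rewrite ?alternating_self // trS expr1 scaleN1r.
  rewrite expr0 scale1r in trS.
  (* [t] solves [q + 2 * t * z 0 j = 0] with [q] the square of [v0]: adding [t] times the radical
     vector makes [v0] isotropic. *)
  pose t := - (v0 *m S *m v0^T) 0 0 / (2%:R * z 0 j).
  pose u := z *m X.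
  have uSv : u *m S *m v0^T = (z 0 j)%:M by rewrite -[u *m S]mulmxA -mulmxA XSv0 zc.
  have vSu : v0 *m S *m u^T = (z 0 j)%:M.
    by rewrite -(tr_scalar_mx _ (z 0 j)) -uSv !trmx_mul !trmxK trS mulmxA.
  have XSu : X *m S *m u^T = 0 by rewrite trmx_mul mulmxA XSX Nz.
  have uSu : u *m S *m u^T = 0 by rewrite -[u *m S]mulmxA -mulmxA XSu mulmx0.
  exists (v0 + t *: u).
    by rewrite linearD linearZ /= mulmxDr XSv0 -scalemxAr XSu scaler0 addr0.
  rewrite linearD linearZ /= !mulmxDl !mulmxDr -?scalemxAr -?scalemxAl.
  rewrite uSu vSu -?scalemxAl -?scalemxAr uSv.
  rewrite [v0 *m S *m v0^T]mx11_scalar !scale_scalar_mx /t.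
  move: ((v0 *m S *m v0^T) 0 0) => q.
  apply/matrixP => i k; rewrite !ord1 !mxE eqxx !mulr1n !mulr0 addr0; field.
  exact: zj.
exists v; split=> //; first by rewrite raddf0.
apply: row_free_ker0 => x; rewrite -[x]hsubmxK mul_row_col => x0.
(* Pairing the relation with the radical vector kills the [X] part and isolates the coefficient of
   [v]. *)
have /(congr1 (mulmx^~ (S *m (z *m X)^T))) := x0.
rewrite mul0mx mulmxDl.
have -> : lsubmx x *m X *m (S *m (z *m X)^T) = 0.
  by rewrite trmx_mul -!mulmxA [S *m _]mulmxA [X *m _]mulmxA [X *m _]mulmxA XSX Nz mulmx0.
have -> : rsubmx x *m v *m (S *m (z *m X)^T) = rsubmx x *m (((-1) ^+ b * z 0 j)%:M).
  rewrite -mulmxA; congr (_ *m _); apply: trmx_inj.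
  rewrite !trmx_mul !trmxK trS -scalemxAr -scalemxAl -[z *m X *m S]mulmxA -mulmxA XSv zc.
  by rewrite tr_scalar_mx scale_scalar_mx.
rewrite add0r mul_mx_scalar => /eqP; rewrite scaler_eq0 mulf_eq0 signr_eq0 (negPf zj) /=.
move=> /eqP r0; move: x0; rewrite r0 mul0mx addr0 => /row_free_inj0 -> //.
by rewrite row_mx0.
Qed.

(** Induction on the codimension: [gram_extension] adds to both systems a vector with the same
    products, until they are bases and [Q] is [invmx X *m Y]. *)
Lemma witt_extension (b : bool) n (S S' : 'M[F]_n) r (X Y : 'M[F]_(r, n)) :
  S \in unitmx -> S' \in unitmx ->
  S^T = (-1) ^+ b *: S -> S'^T = (-1) ^+ b *: S' ->
  row_free X -> row_free Y -> X *m S *m X^T = Y *m S' *m Y^T ->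
  exists Q : 'M[F]_n, Q *m S' *m Q^T = S /\ X *m Q = Y.
Proof.
move=> uS uS' trS trS' fX fY.
have [j rj] : exists j, (r + j)%N = n.
  exists (n - r)%N; rewrite subnKC //.
  by move: fX; rewrite /row_free => /eqP <-; apply: rank_leq_col.
elim: j r rj X Y fX fY => [|j IHj] r rj X Y fX fY gXY.
  have {}rj : r = n by rewrite -rj addn0.
  subst r; move: fX fY; rewrite !row_free_unit => uX uY.
  exists (invmx X *m Y); rewrite mulKVmx //; split=> //.
  rewrite trmx_mul !mulmxA -[_ *m Y *m S']mulmxA -[_ *m (Y *m S') *m Y^T]mulmxA -gXY.
  by rewrite -!mulmxA mulKmx // -trmx_mul mulVmx // trmx1 mulmx1.
have [c [d ext]] := gram_extension b (X *m S *m X^T).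
have ltrn : (r < n)%N by rewrite -rj -addSnnS leq_addr.
have [v [Xv vv fv]] := ext n S X ltrn uS trS erefl fX.
have [w [Yw ww fw]] := ext n S' Y ltrn uS' trS' (esym gXY) fY.
have flip (T : 'M[F]_n) (Z : 'M_(r, n)) u : T^T = (-1) ^+ b *: T ->
    u *m T *m Z^T = (-1) ^+ b *: (Z *m T *m u^T)^T.
  move=> trT; rewrite !trmx_mul trmxK trT -scalemxAl -scalemxAr mulmxA.
  by rewrite scalerA -expr2 sqrr_sign scale1r.
have rj1 : (r + 1 + j)%N = n by rewrite addn1 addSnnS.
have [|Q [QS XQ]] := IHj (r + 1)%N rj1 (col_mx X v) (col_mx Y w) fv fw.
  rewrite !mul_col_mx !tr_col_mx !mul_mx_row gXY Xv Yw vv ww.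
  by rewrite (flip _ S X v) // (flip _ S' Y w) // Xv Yw.
by exists Q; split=> //; move: XQ; rewrite mul_col_mx => /eq_col_mx[].
Qed.

(** Witt's theorem applied to the empty system of vectors. *)
Lemma congruent_forms (b : bool) n (S S' : 'M[F]_n) :
  S \in unitmx -> S' \in unitmx ->
  S^T = (-1) ^+ b *: S -> S'^T = (-1) ^+ b *: S' ->
  exists2 Q : 'M[F]_n, Q \in unitmx & Q *m S' *m Q^T = S.
Proof.
move=> uS uS' trS trS'.
have free0 : row_free (0 : 'M[F]_(0, n)) by rewrite /row_free mxrank0.
have [|Q [QS _]] := witt_extension uS uS' trS trS' free0 free0.
  by rewrite !mul0mx.
by exists Q => //; move: uS; rewrite -QS !unitmx_mul => /andP[/andP[]].
Qed.

End Witt.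

Section Blocks.
Variable R : realType.
Local Notation C := R[i].
Local Notation J := (Jmx R).
Local Notation ii := (Complex (0 : R) 1).

(** * Reduction to the off-diagonal block *)

Lemma tr_Jmx m : (J m)^T = - J m.
Proof.
apply/matrixP => i j; rewrite !mxE.
have [oi|oi] := boolP (odd i); have [oj|oj] := boolP (odd j); rewrite /=.
- by rewrite !ifF ?oppr0 //; lia.
- by case: ifP; rewrite ?opprK ?oppr0.
- by case: ifP; rewrite ?oppr0.
- by rewrite !ifF ?oppr0 //; lia.
Qed.

(** Row [i] has at most one nonzero entry, in the column paired with [i]; this reduces sums over a
    row to single terms. *)
Lemma JmxE m (i j : 'I_m) :
  J m i j = if (j == (if odd i then i.-1 else i.+1) :> nat) then (-1) ^+ odd i else 0.
Proof.
rewrite !mxE; have [oi|oi] := boolP (odd i); rewrite /= ?expr0 ?expr1 //.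
by congr (if _ then _ else _); apply/eqP/eqP; lia.
Qed.

Lemma mul_Jmx m : ~~ odd m -> J m *m J m = - 1%:M.
Proof.
move=> om; apply/matrixP => i j; rewrite !mxE.
have lts : ((if odd i then i.-1 else i.+1) < m)%N.
  by have := ltn_ord i; case: ifP => oi; lia.
rewrite (bigD1 (Ordinal lts)) //= big1 => [|l]; last first.
  by rewrite -val_eqE /= JmxE => /negPf ->; rewrite mul0r.
rewrite addr0 !JmxE /= eqxx.
have -> : odd (if odd i then i.-1 else i.+1) = ~~ odd i by case: ifP => oi; lia.
have -> : (if ~~ odd i then (if odd i then i.-1 else i.+1).-1
           else (if odd i then i.-1 else i.+1).+1) = i.
  by have [oi|oi] := boolP (odd i); rewrite //=; lia.
rewrite -val_eqE eq_sym; case: ifP => _; rewrite ?mulr0 ?oppr0 //.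
by case: odd; rewrite /= ?expr0 ?expr1 ?mulr1 ?mul1r.
Qed.

Lemma Jmx_unit m : ~~ odd m -> J m \in unitmx.
Proof.
move=> om; have /mulmx1_unit[] // : J m *m - J m = 1%:M.
by rewrite mulmxN mul_Jmx // opprK.
Qed.

Lemma tr_Jmx_sign m : (J m)^T = (-1) ^+ true *: J m.
Proof. by rewrite tr_Jmx expr1 scaleN1r. Qed.

Lemma tr_one_sign k : (1%:M : 'M[C]_k)^T = (-1) ^+ false *: 1%:M.
Proof. by rewrite trmx1 expr0 scale1r. Qed.

Lemma skew_unit_even m (A : 'M[C]_m) : A^T = - A -> A \in unitmx -> ~~ odd m.
Proof.
move=> skA; rewrite unitmxE unitfE; apply: contra => om.
have: \det A = - \det A.
  by rewrite -{1}det_tr skA -scaleN1r detZ -signr_odd om expr1 mulN1r.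
by move/eqP; rewrite -addr_eq0 -mulr2n mulrn_eq0.
Qed.

Lemma orthogonal_tr k (P : 'M[C]_k) : P *m P^T = 1%:M -> P^T *m P = 1%:M.
Proof. exact: mulmx1C. Qed.

(** [- J m *m Q^T *m J m] is a right inverse of [Q], hence also a left inverse. *)
Lemma symplectic_tr m (Q : 'M[C]_m) :
  ~~ odd m -> Q *m J m *m Q^T = J m -> Q^T *m J m *m Q = J m.
Proof.
move=> om QJ; have : Q *m (- J m *m Q^T *m J m) = 1%:M.
  by rewrite !mulNmx mulmxN !mulmxA QJ mul_Jmx // opprK.
move/mulmx1C; rewrite !mulNmx => /(congr1 (mulmx (J m))).
by rewrite mulmxN !mulmxA mul_Jmx // mulmx1 !mulNmx mul1mx opprK.
Qed.

(* The action of O(k) x Sp(m) on the off-diagonal block. *)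
Definition block_equiv k m (B B' : 'M[C]_(k, m)) :=
  exists (P : 'M[C]_k) (Q : 'M[C]_m),
    [/\ P *m P^T = 1%:M, Q *m J m *m Q^T = J m & B' = P *m B *m Q^T].

Lemma orthogonal_witt r k (X Y : 'M[C]_(r, k)) :
  row_free X -> row_free Y -> X *m X^T = Y *m Y^T ->
  exists P : 'M[C]_k, P *m P^T = 1%:M /\ X *m P = Y.
Proof.
move=> fX fY gXY.
have [|P []] := witt_extension (unitmx1 C k) (unitmx1 C k) (tr_one_sign k) (tr_one_sign k) fX fY.
  by rewrite !mulmx1.
by rewrite mulmx1; exists P.
Qed.

Lemma symplectic_witt r m (X Y : 'M[C]_(r, m)) :
  ~~ odd m -> row_free X -> row_free Y -> X *m J m *m X^T = Y *m J m *m Y^T ->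
  exists Q : 'M[C]_m, Q *m J m *m Q^T = J m /\ X *m Q^T = Y.
Proof.
move=> om fX fY gXY; have uJ := Jmx_unit om.
have [Q [QJ XQ]] := witt_extension uJ uJ (tr_Jmx_sign m) (tr_Jmx_sign m) fX fY gXY.
by exists Q^T; rewrite trmxK symplectic_tr.
Qed.

Lemma sspace_mul k m (P P' S : 'M[C]_k) (Q Q' A : 'M[C]_m)
    (B : 'M[C]_(k, m)) (B' : 'M[C]_(m, k)) :
  sspace P Q *m block_mx S B B' A *m (sspace P' Q')^T =
  block_mx (P *m S *m P'^T) (P *m B *m Q'^T) (Q *m B' *m P'^T) (Q *m A *m Q'^T).
Proof.
rewrite /sspace tr_block_mx !trmx0 !mulmx_block.
by rewrite !(mul0mx, mulmx0, addr0, add0r).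
Qed.

Lemma canonical_block k m (G : 'M[C]_(k + m)) :
  supersym G -> nondeg_restrictions G ->
  ~~ odd m /\ exists B : 'M[C]_(k, m), sequiv G (canon B).
Proof.
move=> [symS skA trB]; rewrite /nondeg_restrictions -!unitfE -!unitmxE => -[uS uA].
have om := skew_unit_even skA uA; split=> //.
have [P uP PS] := congruent_forms (unitmx1 C k) uS (tr_one_sign k)
  (etrans symS (esym (scale1r _))).
have [Q uQ QA] := congruent_forms (Jmx_unit om) uA (tr_Jmx_sign m)
  (etrans skA (esym (scaleN1r _))).
exists (P *m ursubmx G *m Q^T), P, Q; split=> //.
by rewrite -[in RHS](submxK G) sspace_mul PS QA trB /canon !trmx_mul trmxK mulmxA.
Qed.

Lemma orthogonal_unit k (P : 'M[C]_k) : P *m P^T = 1%:M -> P \in unitmx.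
Proof. by move/mulmx1_unit=> []. Qed.

Lemma symplectic_unit m (Q : 'M[C]_m) :
  ~~ odd m -> Q *m J m *m Q^T = J m -> Q \in unitmx.
Proof.
move=> om QJ; have := Jmx_unit om.
by rewrite -QJ !unitmx_mul => /andP[/andP[]].
Qed.

Lemma block_equiv_sequiv k m (B B' : 'M[C]_(k, m)) :
  ~~ odd m -> block_equiv B B' -> sequiv (canon B) (canon B').
Proof.
move=> om [P [Q [PP QJ ->]]]; exists P, Q.
split; [exact: orthogonal_unit | exact: symplectic_unit |].
by rewrite sspace_mul mulmx1 PP QJ /canon !trmx_mul trmxK mulmxA.
Qed.

(** Comparing diagonal blocks shows that the equivalence itself is orthogonal on the even part and
    symplectic on the odd part. *)
Lemma sequiv_canon k m (B B' : 'M[C]_(k, m)) :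
  sequiv (canon B) (canon B') -> block_equiv B B'.
Proof.
move=> [P [Q [_ _]]]; rewrite sspace_mul mulmx1 => /eq_block_mx[PP PBQ _ QJ].
by exists P, Q.
Qed.

Lemma sequiv_trans k m (G1 G2 G3 : 'M[C]_(k + m)) :
  sequiv G1 G2 -> sequiv G2 G3 -> sequiv G1 G3.
Proof.
move=> [P [Q [uP uQ ->]]] [P' [Q' [uP' uQ' ->]]].
exists (P' *m P), (Q' *m Q); split; rewrite ?unitmx_mul ?uP ?uQ ?uP' ?uQ' //.
have -> : sspace (P' *m P) (Q' *m Q) = sspace P' Q' *m sspace P Q.
  by rewrite /sspace mulmx_block !(mul0mx, mulmx0, addr0, add0r).
by rewrite trmx_mul !mulmxA.
Qed.

(** * Reducibility in terms of idempotents *)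

(** [E0] and [E1] are the projections onto the first summand along the second; the summands are
    nonzero when the pair is neither zero nor the identity. *)
Lemma reducibleP k m (G : 'M[C]_(k + m)) :
  reducible G <->
  exists (E0 : 'M[C]_k) (E1 : 'M[C]_m),
    [/\ E0 *m E0 = E0, E1 *m E1 = E1, (E0 != 0) || (E1 != 0),
        (E0 != 1%:M) || (E1 != 1%:M) &
        sspace E0 E1 *m G *m (sspace (1%:M - E0) (1%:M - E1))^T = 0].
Proof.
split=> [[U0 [W0 [U1 [W1 [/andP[cap0 sum0] /andP[cap1 sum1] U_n0 W_n0 UGW]]]]]|].
  have proj n (U W : 'M[C]_n) : (U :&: W == (0 : 'M[C]_n))%MS ->
      (U + W == (1%:M : 'M[C]_n))%MS ->
      exists2 E, E *m E = E & [/\ (E <= U)%MS, (1%:M - E <= W)%MS, U *m E = U & W *m E = 0].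
    move=> /andP[]; rewrite submx0 => /eqP UW0 _ /andP[_ UW1].
    exists (proj_mx U W); first by rewrite proj_mx_proj.
    split; [ | | by rewrite proj_mx_id | by rewrite proj_mx_0].
      by rewrite -[proj_mx U W]mul1mx proj_mx_sub.
    by rewrite -[X in (1%:M - X)]mul1mx proj_mx_compl_sub.
  have [E0 E00 [/submxP[X0 sU0] /submxP[Y0 sW0] U0E W0E]] := proj _ _ _ cap0 sum0.
  have [E1 E11 [/submxP[X1 sU1] /submxP[Y1 sW1] U1E W1E]] := proj _ _ _ cap1 sum1.
  exists E0, E1; split=> //.
  - apply: contraLR U_n0; rewrite !negb_or !negbK => /andP[/eqP E0z /eqP E1z].
    by rewrite -U0E -U1E E0z E1z !mulmx0 !eqxx.
  - apply: contraLR W_n0; rewrite !negb_or !negbK => /andP[/eqP E0z /eqP E1z].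
    by move: W0E W1E; rewrite E0z E1z !mulmx1 => -> ->; rewrite !eqxx.
  (* The rows of the idempotents lie in [U] and those of their complements in [W], so orthogonality
     is inherited. *)
  - have -> : sspace E0 E1 = sspace X0 X1 *m sspace U0 U1.
      by rewrite /sspace mulmx_block !(mul0mx, mulmx0, addr0, add0r) -sU0 -sU1.
    have -> : sspace (1%:M - E0) (1%:M - E1) = sspace Y0 Y1 *m sspace W0 W1.
      by rewrite /sspace mulmx_block !(mul0mx, mulmx0, addr0, add0r) -sW0 -sW1.
    rewrite trmx_mul -!mulmxA [G *m _]mulmxA [_ *m (_ *m _^T)]mulmxA.
    by rewrite [sspace U0 _ *m _]mulmxA UGW mul0mx mulmx0.
move=> [E0 [E1 [E00 E11 E_n0 E_n1 EGE]]].
have compl n (E : 'M[C]_n) : E *m E = E ->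
    (E :&: (1%:M - E) == (0 : 'M[C]_n))%MS && (E + (1%:M - E) == (1%:M : 'M[C]_n))%MS.
  move=> EE; rewrite submx1 sub0mx submx0 !andbT; apply/andP; split.
    apply/rowV0P => v; rewrite sub_capmx => /andP[/submxP[x ->] /submxP[y xy]].
    by rewrite -EE mulmxA xy -mulmxA mulmxBl mul1mx EE subrr mulmx0.
  rewrite -[X in (X <= _)%MS](subrK E) addrC.
  by rewrite (submx_trans (addmx_sub_adds (submx_refl _) (submx_refl _))).
exists E0, (1%:M - E0), E1, (1%:M - E1); split=> //; try exact: compl.
by rewrite !subr_eq0 ![1%:M == _]eq_sym.
Qed.

Lemma sequiv_reducible k m (G1 G2 : 'M[C]_(k + m)) :
  sequiv G1 G2 -> reducible G2 -> reducible G1.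
Proof.
move=> [P [Q [uP uQ ->]]] /reducibleP[E0 [E1 [E00 E11 E_n0 E_n1 EGE]]].
have conj n (T E : 'M[C]_n) : T \in unitmx -> E *m E = E ->
    let E' := invmx T *m E *m T in E' *m E' = E'.
  by move=> uT EE /=; rewrite !mulmxA mulmxK // -[_ *m E *m E]mulmxA EE.
(* Stated for a scalar matrix in order to cover both 0 and 1. *)
have conj_eq n (T E : 'M[C]_n) a : T \in unitmx ->
    (invmx T *m E *m T == a%:M) = (E == a%:M).
  move=> uT; apply/eqP/eqP => [|->]; last by rewrite -mulmxA -scalar_mxC mulKmx.
  move/(congr1 (mulmx T)); rewrite !mulmxA mulmxV // mul1mx scalar_mxC.
  by move/(congr1 (mulmx^~ (invmx T))); rewrite !mulmxK.
apply/reducibleP; exists (invmx P *m E0 *m P), (invmx Q *m E1 *m Q).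
split; [exact: conj | exact: conj | | | ].
- rewrite -[0 in X in X || _](raddf0 (@scalar_mx C k)).
  by rewrite -[0 in X in _ || X](raddf0 (@scalar_mx C m)) !conj_eq // !raddf0.
- by rewrite !conj_eq.
have split0 n (T E : 'M[C]_n) : T \in unitmx ->
    1%:M - invmx T *m E *m T = invmx T *m (1%:M - E) *m T.
  by move=> uT; rewrite mulmxBr mulmxBl mulmx1 mulVmx.
rewrite !split0 //.
have fac (X0 : 'M[C]_k) (X1 : 'M[C]_m) :
    sspace (invmx P *m X0 *m P) (invmx Q *m X1 *m Q) =
    sspace (invmx P) (invmx Q) *m sspace X0 X1 *m sspace P Q.
  by rewrite /sspace !mulmx_block !(mul0mx, mulmx0, addr0, add0r).
rewrite !fac !trmx_mul.
set A := sspace (invmx P) _; set D := sspace P Q.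
have -> : A *m sspace E0 E1 *m D *m G1 *m (D^T *m ((sspace (1%:M - E0) (1%:M - E1))^T *m A^T))
  = A *m (sspace E0 E1 *m (D *m G1 *m D^T) *m (sspace (1%:M - E0) (1%:M - E1))^T) *m A^T.
  by rewrite !mulmxA.
by rewrite EGE mulmx0 mul0mx.
Qed.

(** The diagonal blocks of the orthogonality relation read [E0 = E0 *m E0^T] and
    [E1 *m J m = E1 *m J m *m E1^T]. The right sides are symmetric and skew respectively, which
    makes both idempotents self-adjoint. *)
Lemma canon_reducibleP k m (B : 'M[C]_(k, m)) :
  reducible (canon B) <->
  exists (E0 : 'M[C]_k) (E1 : 'M[C]_m),
    [/\ [/\ E0 *m E0 = E0, E1 *m E1 = E1, E0^T = E0 & E1 *m J m = J m *m E1^T],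
        (E0 != 0) || (E1 != 0), (E0 != 1%:M) || (E1 != 1%:M) &
        E0 *m B = B *m E1^T].
Proof.
rewrite reducibleP; split=> -[E0 [E1]].
  rewrite sspace_mul -block_mx0 => -[E00 E11 E_n0 E_n1 /eq_block_mx[]].
  rewrite mulmx1 !linearB /= !trmx1 ?mulmxBr !mulmx1.
  move=> /subr0_eq eS /subr0_eq eB /subr0_eq eB' /subr0_eq eJ.
  have symE : E0^T = E0 by rewrite {1}eS trmx_mul trmxK -eS.
  exists E0, E1; split=> //.
    split=> //; apply: oppr_inj; transitivity (E1 *m J m)^T.
      by rewrite eJ !trmx_mul trmxK tr_Jmx mulNmx mulmxN mulmxA.
    by rewrite trmx_mul tr_Jmx mulNmx.
  rewrite {1}eB -[LHS]trmxK -[RHS]trmxK; congr _^T.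
  by rewrite !trmx_mul !trmxK symE eB' symE mulmxA.
move=> [[E00 E11 symE EJ] E_n0 E_n1 EB]; exists E0, E1; split=> //.
rewrite sspace_mul -block_mx0 !linearB /= !trmx1 ?mulmxBr !mulmx1 symE E00.
have EE11 : E1^T *m E1^T = E1^T by rewrite -trmx_mul E11.
have EB' : E1 *m B^T = B^T *m E0 by rewrite -[E1]trmxK -trmx_mul -EB trmx_mul symE.
by rewrite EB EJ EB' -!mulmxA EE11 E00 !subrr.
Qed.

(** * Constraints imposed by irreducibility *)

Lemma one_mx_neq0 n : (0 < n)%N -> (1%:M : 'M[C]_n) != 0.
Proof. by case: n => // n _; rewrite oner_neq0. Qed.

(** [E] is the orthogonal projection onto the line of the non-isotropic vector [u], acting on rows
    from the right. *)
Lemma line_projection n (u : 'rV[C]_n) c :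
  u *m u^T = c%:M -> c != 0 ->
  let E := c^-1 *: (u^T *m u) in [/\ E *m E = E, E^T = E, u *m E = u & E != 0].
Proof.
move=> uu c0 /=.
have uE : u *m (c^-1 *: (u^T *m u)) = u.
  by rewrite -scalemxAr mulmxA uu mul_scalar_mx scalerA mulVf // scale1r.
split=> //.
- by rewrite -{1}scalemxAl -mulmxA uE.
- by rewrite linearZ /= trmx_mul trmxK.
- apply: contraNneq c0 => E0; move: uE; rewrite E0 mulmx0 => u0.
  by move/matrixP/(_ 0 0): uu; rewrite -u0 mul0mx !mxE mulr1n => <-.
Qed.

(** [E] is the projection onto the hyperbolic plane of [a] and [b], orthogonal for [J n]. *)
Lemma plane_projection n (a b : 'rV[C]_n) c :
  a *m J n *m b^T = c%:M -> c != 0 ->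
  let E := c^-1 *: (J n *m (b^T *m a - a^T *m b)) in
  [/\ E *m E = E, E *m J n = J n *m E^T, a *m E = a & E != 0].
Proof.
move=> ab c0 /=; set E := _ *: _.
have aa := alternating_self a (tr_Jmx n).
have bb := alternating_self b (tr_Jmx n).
have ba : b *m J n *m a^T = - c%:M.
  apply: trmx_inj; rewrite !trmx_mul trmxK tr_Jmx linearN /= tr_scalar_mx -ab.
  by rewrite mulNmx mulmxN mulmxA.
have aE : a *m E = a.
  rewrite -scalemxAr mulmxA mulmxBr !mulmxA ab aa mul0mx subr0.
  by rewrite mul_scalar_mx scalerA mulVf // scale1r.
have bE : b *m E = b.
  rewrite -scalemxAr mulmxA mulmxBr !mulmxA ba bb mul0mx sub0r.
  by rewrite mulNmx opprK mul_scalar_mx scalerA mulVf // scale1r.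
split=> //.
- by rewrite {1}/E -scalemxAl -mulmxA mulmxBl -!mulmxA aE bE.
- rewrite /E [(_ *: _)^T]linearZ /= -scalemxAl -scalemxAr trmx_mul.
  rewrite [(_ - _)^T]linearB /= !trmx_mul !trmxK.
  by rewrite tr_Jmx mulmxN -mulNmx opprB !mulmxA.
- apply: contraNneq c0 => E0; move: aE; rewrite E0 mulmx0 => a0.
  by move/matrixP/(_ 0 0): ab; rewrite -a0 !mul0mx !mxE mulr1n => <-.
Qed.

(** The rank hypothesis forces the rows of [N] to span the whole left kernel of [X]. *)
Lemma submx_max_kernel p q n s (N : 'M[C]_(p, n)) (X : 'M[C]_(n, q)) (Y : 'M[C]_(s, n)) :
  N *m X = 0 -> (n <= \rank N + \rank X)%N -> Y *m X = 0 -> (Y <= N)%MS.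
Proof.
move=> NX rNX YX; have NK : (N <= kermx X)%MS by apply/sub_kermxP.
have [_ /esym] := mxrank_leqif_sup NK.
have -> : (\rank N == \rank (kermx X)).
  rewrite eqn_leq mxrankS //= mxrank_ker leq_subLR addnC.
  exact: rNX.
by move/(submx_trans _); apply; apply/sub_kermxP.
Qed.

Section Irreducible.
Variables (k m : nat) (B : 'M[C]_(k, m)).
Hypothesis irrB : irreducible (canon B).

(** Otherwise the line of [u] would be a purely even summand; [0 < m] makes its complement
    nonzero. *)
Lemma irreducible_left_kernel (u : 'rV[C]_k) :
  (0 < m)%N -> u *m B = 0 -> u *m u^T = 0.
Proof.
move=> m0 uB; apply/eqP/negPn/negP => /mx11_neq0 uu; apply: irrB.
have [EE ET uE E0] := line_projection (mx11_scalar _) uu.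
apply/canon_reducibleP; exists (((u *m u^T) 0 0)^-1 *: (u^T *m u)), 0.
split; rewrite ?E0 ?[0 == 1%:M]eq_sym ?one_mx_neq0 ?orbT //.
  by split; rewrite // ?mulmx0 // trmx0 mul0mx mulmx0.
by rewrite -scalemxAl -mulmxA uB !mulmx0 scaler0 trmx0 mulmx0.
Qed.

(** Otherwise the plane of [a] and [b] would be a purely odd summand; [0 < k] makes its complement
    nonzero. *)
Lemma irreducible_right_kernel (a b : 'rV[C]_m) :
  (0 < k)%N -> B *m a^T = 0 -> B *m b^T = 0 -> a *m J m *m b^T = 0.
Proof.
move=> k0 Ba Bb; apply/eqP/negPn/negP => /mx11_neq0 ab; apply: irrB.
have [EE EJ aE E0] := plane_projection (mx11_scalar _) ab.
apply/canon_reducibleP.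
exists 0, (((a *m J m *m b^T) 0 0)^-1 *: (J m *m (b^T *m a - a^T *m b))).
split; rewrite ?E0 ?[0 == 1%:M]eq_sym ?one_mx_neq0 ?orbT //.
  by split; rewrite // ?mulmx0 // trmx0.
rewrite mul0mx [(_ *: _)^T]linearZ /= -scalemxAr trmx_mul [(_ - _)^T]linearB /= !trmx_mul !trmxK.
by rewrite mulmxA mulmxBr !mulmxA Ba Bb !mul0mx subr0 mul0mx scaler0.
Qed.

(* A non-isotropic such [u] would split off the form spanned by [u],
   [- u B J] and [b]. *)
Lemma irreducible_column_space (u : 'rV[C]_k) (b : 'rV[C]_m) :
  ~~ odd m -> (1 < k)%N -> B *m b^T = u^T -> u *m B *m J m *m B^T = 0 -> u *m u^T = 0.
Proof.
move=> om k1 Bb uK; apply/eqP/negPn/negP => /mx11_neq0 uu; apply: irrB.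
have [EE ET uE E0] := line_projection (mx11_scalar _) uu.
set c := (u *m u^T) 0 0 in uu EE ET uE E0 *.
(* This choice gives [a *m J m *m b^T = u *m u^T], while the hypothesis on [u] says that [B] kills
   [a^T]. *)
pose a := - (u *m B *m J m).
have ab : a *m J m *m b^T = c%:M.
  rewrite mulNmx -[u *m B *m _ *m _]mulmxA mul_Jmx // mulmxN mulmx1 opprK.
  by rewrite -mulmxA Bb -mx11_scalar.
have Ba : B *m a^T = 0.
  apply: trmx_inj; rewrite trmx_mul trmxK trmx0 mulNmx uK oppr0 //.
have [FF FJ aF F0] := plane_projection ab uu.
apply/canon_reducibleP.
exists (c^-1 *: (u^T *m u)), (c^-1 *: (J m *m (b^T *m a - a^T *m b))).
split; rewrite ?E0 //.
  (* The line projection has rank at most 1, so it differs from the identity when [1 < k]. *)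
  apply/orP; left; apply: contraTneq k1 => /(congr1 mxrank).
  rewrite mxrank1 -leqNgt => <-; rewrite mxrank_scale_nz ?invr_eq0 //.
  by apply: leq_trans (mxrankM_maxr _ _) _; rewrite rank_leq_row.
rewrite [(_ *: _)^T]linearZ /= -scalemxAr -scalemxAl; congr (_ *: _).
rewrite trmx_mul [(_ - _)^T]linearB /= !trmx_mul !trmxK mulmxA mulmxBr !mulmxA Ba Bb.
rewrite mul0mx sub0r tr_Jmx mulNmx mulmxN opprK /a mulmxN mulNmx.
by rewrite -!mulmxA mul_Jmx // !mulmxN mulmx1 opprK.
Qed.

Lemma isotropic_kermx : (0 < m)%N -> kermx B *m (kermx B)^T = 0.
Proof.
move=> m0; move: (kermx B) (mulmx_ker B) => N NB.
apply/eqP/negPn/negP => /sym_anisotropic[|x]; first by rewrite trmx_mul trmxK.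
rewrite !mulmxA -mulmxA -trmx_mul irreducible_left_kernel ?eqxx //.
by rewrite -mulmxA NB mulmx0.
Qed.

Lemma isotropic_kermx_tr : (0 < k)%N -> kermx B^T *m J m *m (kermx B^T)^T = 0.
Proof.
move=> k0; apply/matrixP => i j; set N := kermx _.
have kerB l : B *m (row l N)^T = 0.
  apply: trmx_inj; rewrite trmx_mul trmxK -row_mul mulmx_ker.
  by rewrite !linear0.
have /matrixP/(_ 0 0) := irreducible_right_kernel k0 (kerB i) (kerB j).
rewrite -row_mul; move: (N *m J m) => M.
rewrite [LHS]mxE [RHS]mxE => E; rewrite mxE [RHS]mxE -[RHS]E.
by apply: eq_bigr => l _; rewrite !mxE.
Qed.

(** The left kernel of [B] has dimension [k - \rank B], and a totally isotropic subspace has at most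
    half the dimension of the space. *)
Lemma dim_left_le : (0 < m)%N -> (k <= 2 * \rank B)%N.
Proof.
move=> m0; have := mulmx0_rank_max (isotropic_kermx m0).
rewrite mxrank_tr mxrank_ker; have := rank_leq_row B; lia.
Qed.

Lemma dim_right_le : ~~ odd m -> (0 < k)%N -> (m <= 2 * \rank B)%N.
Proof.
move=> om k0; have := mulmx0_rank_max (isotropic_kermx_tr k0).
rewrite mxrankMfree ?row_free_unit ?Jmx_unit // mxrank_tr mxrank_ker mxrank_tr.
have := rank_leq_col B; lia.
Qed.

(** In the extremal dimension the left kernel of [B] is its own orthogonal complement; the columns
    of [B], being orthogonal to it, lie in it. *)
Lemma left_gram0 : (0 < m)%N -> k = (2 * \rank B)%N -> B^T *m B = 0.
Proof.
move=> m0 kr; apply/sub_kermxP; apply: (submx_max_kernel (isotropic_kermx m0)).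
  by rewrite mxrank_tr mxrank_ker; lia.
by rewrite -trmx_mul mulmx_ker trmx0.
Qed.

(** The same argument on the odd side: the kernel of [B] is Lagrangian, and the rows of [B *m J m]
    are orthogonal to it for [J m]. *)
Lemma right_gram0 :
  ~~ odd m -> (0 < k)%N -> m = (2 * \rank B)%N -> B *m J m *m B^T = 0.
Proof.
move=> om k0 mr; apply/sub_kermxP.
have rN : \rank (kermx B^T) = (m - \rank B)%N by rewrite mxrank_ker mxrank_tr.
move: (isotropic_kermx_tr k0) (mulmx_ker B^T) rN; rewrite -mulmxA.
move: (kermx B^T) => N iso NB rN; apply: (submx_max_kernel iso).
  rewrite -[X in (_ + X)%N]mxrank_tr trmx_mul trmxK.
  by rewrite mxrankMfree ?row_free_unit ?unitmx_tr ?Jmx_unit //; lia.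
rewrite mulmxA -[B *m J m *m J m]mulmxA mul_Jmx // mulmxN mulmx1 mulNmx.
by rewrite -[B in X in - X]trmxK -trmx_mul NB trmx0 oppr0.
Qed.

(** Since [B *m J m *m B^T = 0], [irreducible_column_space] makes every column combination
    [x *m B^T] isotropic. Hence [B^T *m B = 0], and the column space has at most half the dimension
    [k]. *)
Lemma dim_right_le_left :
  ~~ odd m -> (1 < k)%N -> m = (2 * \rank B)%N -> (m <= k)%N.
Proof.
move=> om k1 mr; have k0 : (0 < k)%N by lia.
have K0 := right_gram0 om k0 mr.
have [/mulmx0_rank_max|] := eqVneq (B^T *m B) 0.
  by rewrite mxrank_tr; lia.
case/sym_anisotropic=> [|x]; first by rewrite trmx_mul trmxK.
rewrite !mulmxA -mulmxA -[B *m x^T]trmxK trmx_mul trmxK.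
rewrite (@irreducible_column_space _ x) ?eqxx // ?trmx_mul ?trmxK //.
by rewrite -!mulmxA [B *m _]mulmxA K0 !mulmx0.
Qed.

End Irreducible.
(** * Entrywise computation with explicit matrices *)

(* Entries are indexed by [nat] so that the products of explicit matrices
   reduce by computation, without ordinals. *)
Definition nat_mx k m (f : nat -> nat -> C) : 'M[C]_(k, m) := \matrix_(i, j) f i j.

Definition nat_dot n (a b : nat -> C) := foldr (fun l s => a l * b l + s) 0 (iota 0 n).

Lemma nat_mxM k n p f g :
  nat_mx k n f *m nat_mx n p g =
  nat_mx k p (fun i j => nat_dot n (f i) (fun l => g l j)).
Proof.
apply/matrixP => i j; rewrite !mxE /nat_dot.
under eq_bigr do rewrite !mxE.
rewrite -(big_mkord xpredT (fun l => f i l * g l j)) /index_iota subn0.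
by elim: (iota 0 n) => [|l s IHs] /=; rewrite ?big_nil ?big_cons ?IHs.
Qed.

Lemma nat_mxT k m f : (nat_mx k m f)^T = nat_mx m k (fun i j => f j i).
Proof. by apply/matrixP => i j; rewrite !mxE. Qed.

Lemma nat_mxD k m f g :
  nat_mx k m f + nat_mx k m g = nat_mx k m (fun i j => f i j + g i j).
Proof. by apply/matrixP => i j; rewrite !mxE. Qed.

Lemma nat_mxZ k m a f : a *: nat_mx k m f = nat_mx k m (fun i j => a * f i j).
Proof. by apply/matrixP => i j; rewrite !mxE. Qed.

Lemma nat_mx1 n : 1%:M = nat_mx n n (fun i j => (i == j)%:R).
Proof. by apply/matrixP => i j; rewrite !mxE. Qed.

Lemma nat_mx0 k m : 0 = nat_mx k m (fun _ _ => 0).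
Proof. by apply/matrixP => i j; rewrite !mxE. Qed.

Lemma mx_ofE k m s : mx_of k m s = nat_mx k m (fun i j => nth 0 (nth [::] s i) j).
Proof. by []. Qed.

Lemma Jmx_natE m : J m = nat_mx m m (fun i j =>
  if ~~ odd i && (j == i.+1) then 1 else if odd i && (i == j.+1) then -1 else 0).
Proof. by []. Qed.

Lemma eq_nat_mx k m f g :
  (forall i j, (i < k)%N -> (j < m)%N -> f i j = g i j) -> nat_mx k m f = nat_mx k m g.
Proof. by move=> fg; apply/matrixP => i j; rewrite !mxE fg. Qed.

Lemma ii2 : ii * ii = -1 :> C. Proof. by rewrite -expr2 sqr_i. Qed.

(** Four cases per index cover all the explicit matrices, whose sizes are at most 4; what remains
    are polynomial identities in the entries. *)
Ltac nat_mx_compute :=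
  rewrite ?(mx_ofE, Jmx_natE, nat_mx1, nat_mx0);
  rewrite ?(nat_mxT, nat_mxM, nat_mxD, nat_mxZ);
  apply: eq_nat_mx => - [|[|[|[|//]]]] [|[|[|[|//]]]] // _ _ ;
  rewrite /nat_dot /=;
  rewrite ?(mulr0,mul0r,addr0,add0r,mulr1,mul1r) //.


Local Notation B1 := (mx_of 1 2 [:: [:: 1; 0]] : 'M[C]_(1, 2)).
Local Notation B2 a := (mx_of 2 2 [:: [:: 1; 0]; [:: 0; a]] : 'M[C]_2).
Local Notation B3 := (mx_of 2 2 [:: [:: 1; 0]; [:: ii; 0]] : 'M[C]_2).
Local Notation B4 := (mx_of 3 2 [:: [:: 1; 0]; [:: 0; 1]; [:: 0; ii]] : 'M[C]_(3, 2)).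
Local Notation B5 :=
  (mx_of 3 4 [:: [:: 1; 0; 0; 0]; [:: 0; 1; 1; 0]; [:: 0; 0; 0; ii]] : 'M[C]_(3, 4)).
Local Notation B6 :=
  (mx_of 4 2 [:: [:: 1; 0]; [:: ii; 0]; [:: 0; 1]; [:: 0; ii]] : 'M[C]_(4, 2)).
(** The Gram matrix of the rows of [B5] for [J 4]; its radical is the isotropic line of [kappa]. *)
Local Notation K5 :=
  (mx_of 3 3 [:: [:: 0; 1; 0]; [:: -1; 0; ii]; [:: 0; - ii; 0]] : 'M[C]_3).
Local Notation kappa := (mx_of 1 3 [:: [:: -1; 0; ii]] : 'M[C]_(1, 3)).

Lemma B5_gram : B5 *m J 4 *m B5^T = K5.
Proof. by nat_mx_compute; ring: ii2. Qed.

Lemma kappa_K5 : kappa *m K5 = 0.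
Proof. by nat_mx_compute; ring: ii2. Qed.

Lemma kappa_isotropic : kappa *m kappa^T = 0.
Proof. by nat_mx_compute; ring: ii2. Qed.

(** * Rank-one symmetric matrices and skew matrices of size 2 and 3 *)

Lemma rank_factorization k m r (B : 'M[C]_(k, m)) :
  \rank B = r ->
  exists (u : 'M[C]_(k, r)) (w : 'M[C]_(r, m)),
    [/\ B = u *m w, row_free u^T & row_free w].
Proof.
move=> <-; exists (col_base B), (row_base B).
by rewrite mulmx_base row_base_free /row_free mxrank_tr -/(row_full _) col_base_full.
Qed.

(** If [x *m M *m x^T] is a nonzero scalar [c], rank one gives [M *m x^T *m x *m M = c *: M], so
    [x *m M] divided by a square root of [c] serves as [w]. *)
Lemma sym_rank1 n (M : 'M[C]_n) :
  M^T = M -> \rank M = 1%N -> exists w : 'rV[C]_n, M = w^T *m w.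
Proof.
move=> symM rM; have M0 : M != 0 by rewrite -mxrank_eq0 rM.
have [x /mx11_neq0 xMx] := sym_anisotropic symM M0.
have [u [w [Muw _ _]]] := rank_factorization rM.
set c := _ 0 0 in xMx; have cE : x *m M *m x^T = c%:M by exact: mx11_scalar.
exists ((sqrtC c)^-1 *: (x *m M)).
rewrite [(_ *: _)^T]linearZ /= -scalemxAl -scalemxAr scalerA -expr2 exprVn sqrtCK.
rewrite trmx_mul symM.
have [a xu] : exists a, x *m u = a%:M by eexists; exact: mx11_scalar.
have [b wx] : exists b, w *m x^T = b%:M by eexists; exact: mx11_scalar.
have -> : M *m x^T *m (x *m M) = c *: M.
  have /matrixP/(_ 0 0) := cE.
  rewrite {1}Muw mulmxA xu -mulmxA wx -scalar_mxM !mxE /= !mulr1n => <-.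
  rewrite Muw -[u *m w *m _]mulmxA wx [x *m _]mulmxA xu.
  by rewrite mul_mx_scalar mul_scalar_mx -scalemxAl -scalemxAr scalerA mulrC.
by rewrite scalerA mulVf // scale1r.
Qed.

Lemma skew2E (K : 'M[C]_2) :
  K^T = - K -> K = mx_of 2 2 [:: [:: 0; K 0 1]; [:: - K 0 1; 0]].
Proof.
move=> skK; have e i j : K j i = - K i j by have /matrixP/(_ i j) := skK; rewrite !mxE.
have d i : K i i = 0.
  by have /eqP := e i i; rewrite -addr_eq0 -mulr2n mulrn_eq0 => /eqP.
apply/matrixP => i j; rewrite mxE.
case: i => [[|[|//]] hi]; case: j => [[|[|//]] hj] /=; rewrite -?e.
- by rewrite -[RHS](d 0); congr (K _ _); apply: val_inj.
- by congr (K _ _); apply: val_inj.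
- by congr (K _ _); apply: val_inj.
- by rewrite -[RHS](d 1); congr (K _ _); apply: val_inj.
Qed.

Lemma skew3E (K : 'M[C]_3) : K^T = - K ->
  exists p q r, K = mx_of 3 3 [:: [:: 0; p; q]; [:: - p; 0; r]; [:: - q; - r; 0]].
Proof.
move=> skK; have e i j : K j i = - K i j by have /matrixP/(_ i j) := skK; rewrite !mxE.
have d i : K i i = 0.
  by have /eqP := e i i; rewrite -addr_eq0 -mulr2n mulrn_eq0 => /eqP.
pose i0 : 'I_3 := inord 0; pose i1 : 'I_3 := inord 1; pose i2 : 'I_3 := inord 2.
exists (K i0 i1), (K i0 i2), (K i1 i2).
apply/matrixP => i j; rewrite mxE -!e.
have [vi vj] : i = inord i /\ j = inord j by rewrite !inord_val.
rewrite {1}vi {1}vj.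
by case: i vi => [[|[|[|//]]] hi] _; case: j vj => [[|[|[|//]]] hj] _ //=; rewrite d.
Qed.

(** A skew 3 x 3 matrix is a cross product, hence determined up to a factor by a nonzero kernel
    vector. *)
Lemma skew3_kappa (K : 'M[C]_3) :
  K^T = - K -> kappa *m K = 0 -> exists p, K = p *: K5.
Proof.
move=> /skew3E[p [q [r ->]]].
rewrite mx_ofE [mx_of 3 3 _]mx_ofE nat_mxM (nat_mx0 1 3) => /matrixP e.
have := e 0 (inord 0); rewrite !mxE inordK //= /nat_dot /=.
have := e 0 (inord 1); rewrite !mxE inordK //= /nat_dot /=.
rewrite ?(mulr0,mul0r,addr0,add0r,mulr1,mul1r) => e1 e0.
have q0 : q = 0.
  have : ii * (ii * - q) = 0 by rewrite e0 mulr0.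
  by move=> <-; ring: ii2.
have r0 : r = p * ii.
  have : r - p * ii = ii * (-1 * p + ii * - r) by ring: ii2.
  by rewrite e1 mulr0 => /subr0_eq.
exists p; rewrite q0 r0.
by nat_mx_compute; ring.
Qed.

(** * The canonical blocks *)

(** The rows are [a] times [kappa] and the second basis vector; Witt's theorem on such pairs
    rescales [kappa] by an orthogonal matrix. *)
Local Notation kappa2 a := (mx_of 2 3 [:: [:: - a; 0; a * ii]; [:: 0; 1; 0]] : 'M[C]_(2, 3)).

Lemma column_witt k n (X Y : 'M[C]_(k, n)) :
  row_free X^T -> row_free Y^T -> X^T *m X = Y^T *m Y ->
  exists P : 'M[C]_k, P *m P^T = 1%:M /\ P *m X = Y.
Proof.
move=> fX fY gXY.
have [|P [PP XP]] := orthogonal_witt fX fY; first by rewrite !trmxK.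
exists P^T; rewrite trmxK; split; first exact: orthogonal_tr.
by apply: trmx_inj; rewrite trmx_mul trmxK.
Qed.

Lemma row_free_mul1 k n (X : 'M[C]_(k, n)) T : X *m T = 1%:M -> row_free X.
Proof. by move=> XT; apply/row_freeP; exists T. Qed.

Lemma block_equiv_left k m (P : 'M[C]_k) (B B' : 'M[C]_(k, m)) :
  P *m P^T = 1%:M -> block_equiv (P *m B) B' -> block_equiv B B'.
Proof.
move=> PP [P' [Q [PP' QJ ->]]]; exists (P' *m P), Q; split=> //.
  by rewrite trmx_mul !mulmxA -[P' *m P *m _]mulmxA PP mulmx1.
by rewrite !mulmxA.
Qed.

Lemma block_equiv_right k m (Q : 'M[C]_m) (B B' : 'M[C]_(k, m)) :
  Q *m J m *m Q^T = J m -> block_equiv (B *m Q^T) B' -> block_equiv B B'.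
Proof.
move=> QJ [P [Q' [PP QJ' ->]]]; exists P, (Q' *m Q); split=> //.
  by rewrite trmx_mul !mulmxA -[Q' *m Q *m _]mulmxA -[Q' *m (Q *m _) *m _]mulmxA QJ.
by rewrite trmx_mul !mulmxA.
Qed.

Lemma block_equiv_refl k m (B : 'M[C]_(k, m)) : block_equiv B B.
Proof. by exists 1%:M, 1%:M; split; rewrite ?trmx1 ?mulmx1 ?mul1mx. Qed.

(** Every vector is isotropic for a skew form, so Witt's theorem applies to any two nonzero
    vectors. *)
Lemma symplectic_row m (X Y : 'rV[C]_m) :
  ~~ odd m -> X != 0 -> Y != 0 ->
  exists Q : 'M[C]_m, Q *m J m *m Q^T = J m /\ X *m Q^T = Y.
Proof.
move=> om X0 Y0; apply: symplectic_witt; rewrite // ?alternating_self ?tr_Jmx //.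
all: by rewrite /row_free rank_rV ?X0 ?Y0.
Qed.

Lemma row10_neq0 : (mx_of 1 2 [:: [:: 1; 0]] : 'M[C]_(1, 2)) != 0.
Proof. by apply/matrix0Pn; exists 0, 0; rewrite mxE oner_neq0. Qed.

Lemma block_equiv_1_2 (B : 'M[C]_(1, 2)) : B != 0 -> block_equiv B B1.
Proof.
move=> B0; have [Q [QJ <-]] := symplectic_row (m := 2) isT B0 row10_neq0.
by apply: block_equiv_right QJ (block_equiv_refl _).
Qed.

(** Writing [B = u *m w], the hypothesis makes [u] isotropic; Witt's theorem then moves [u] to
    [(1, i)] and [w] to [(1, 0)] independently. *)
Lemma block_equiv_2_2_rank1 (B : 'M[C]_2) :
  \rank B = 1%N -> B^T *m B = 0 -> block_equiv B B3.
Proof.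
move=> rB BB; have [u [w [Buw fu fw]]] := rank_factorization rB.
have w0 : w != 0 by apply: contraTneq fw => ->; rewrite /row_free mxrank0.
have uu : u^T *m u = 0.
  have : w^T *m (u^T *m u *m w) = 0 by rewrite -BB Buw trmx_mul !mulmxA.
  move/(congr1 trmx); rewrite trmx0 trmx_mul trmxK => /(row_free_inj0 fw).
  by move/(congr1 trmx); rewrite trmxK trmx0 => /(row_free_inj0 fw).
pose v : 'M[C]_(2, 1) := mx_of 2 1 [:: [:: 1]; [:: ii]].
have fv : row_free v^T.
  apply: (@row_free_mul1 _ _ _ (mx_of 2 1 [:: [:: 1]; [:: 0]])).
  by rewrite /v; nat_mx_compute.
have vv : v^T *m v = 0 by rewrite /v; nat_mx_compute; ring: ii2.
have [|P [PP Pu]] := column_witt fu fv; first by rewrite uu vv.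
have [Q [QJ wQ]] := symplectic_row (m := 2) isT w0 row10_neq0.
apply: block_equiv_left PP _; apply: block_equiv_right QJ _.
rewrite Buw mulmxA Pu -mulmxA wQ.
have -> : v *m B1 = B3 by rewrite /v; nat_mx_compute.
exact: block_equiv_refl.
Qed.

(** With [Cplus_opp]: [Cplus] selects exactly one element of each pair of nonzero opposite
    numbers. *)
Lemma Cplus_or_opp (a : C) : a != 0 -> Cplus a \/ Cplus (- a).
Proof.
case: a => x y; rewrite eq_complex /= negb_and /Cplus /= !oppr_gt0 => xy.
have [xlt0|xgt0|x0] := ltgtP x 0; [by right; left|by left; left|].
move: xy; rewrite x0 eqxx /= oppr0 => y0.
by have [ylt0|ygt0|y0'] := ltgtP y 0; [right; right|left; right|rewrite y0' eqxx in y0].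
Qed.

Lemma Cplus_neq0 (a : C) : Cplus a -> a != 0.
Proof.
case: a => x y; rewrite eq_complex /Cplus /= negb_and => -[x0|[_ y0]].
  by rewrite gt_eqF.
by rewrite orbC gt_eqF.
Qed.

Lemma Cplus_opp (a : C) : Cplus a -> ~ Cplus (- a).
Proof.
case: a => x y; rewrite /Cplus /= !oppr_gt0 => -[x0|[-> y0]] -[x1|[x1 y1]].
- by have := lt_trans x0 x1; rewrite ltxx.
- by move/eqP: x1; rewrite oppr_eq0 gt_eqF.
- by rewrite ltxx in x1.
- by have := lt_trans y0 y1; rewrite ltxx.
Qed.

Lemma gram_B2 a : B2 a *m J 2 *m (B2 a)^T = mx_of 2 2 [:: [:: 0; a]; [:: - a; 0]].
Proof. by nat_mx_compute; ring. Qed.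

Lemma row_free_B2 a : a != 0 -> row_free (B2 a).
Proof.
move=> a0; apply: (@row_free_mul1 _ _ _ (mx_of 2 2 [:: [:: 1; 0]; [:: 0; a^-1]])).
by nat_mx_compute; rewrite mulfV.
Qed.

Lemma tr_gram k m (B : 'M[C]_(k, m)) : (B *m J m *m B^T)^T = - (B *m J m *m B^T).
Proof. by rewrite !trmx_mul trmxK tr_Jmx mulNmx mulmxN mulmxA. Qed.

(** The rows of [B] form a basis, so their skew Gram matrix, that is its entry [c], determines [B]
    up to the symplectic group. *)
Lemma block_equiv_2_2_rank2 (B : 'M[C]_2) :
  \rank B = 2%N -> exists2 a, Cplus a & block_equiv B (B2 a).
Proof.
move=> rB; have fB : row_free B by rewrite /row_free rB.
have gB := skew2E (tr_gram B); set c := _ 0 1 in gB.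
have c0 : c != 0.
  have : B *m J 2 *m B^T \in unitmx.
    by rewrite !unitmx_mul unitmx_tr -row_free_unit fB Jmx_unit.
  apply: contraTneq => c0; rewrite gB c0 oppr0 -row_free_unit /row_free.
  rewrite [mx_of _ _ _](_ : _ = 0) ?mxrank0 //.
  by nat_mx_compute.
have direct (X : 'M[C]_2) a : row_free X -> a != 0 ->
    X *m J 2 *m X^T = mx_of 2 2 [:: [:: 0; a]; [:: - a; 0]] -> block_equiv X (B2 a).
  move=> fX a0 gX.
  have [//||Q [QJ <-]] := symplectic_witt _ fX (row_free_B2 a0).
    by rewrite gX gram_B2.
  by apply: block_equiv_right QJ (block_equiv_refl _).
have [cP|cP] := Cplus_or_opp c0; first by exists c => //; apply: direct.
(* A reflection of the even part changes the sign of [c]. *)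
exists (- c) => //; pose P : 'M[C]_2 := mx_of 2 2 [:: [:: 1; 0]; [:: 0; -1]].
have PP : P *m P^T = 1%:M by rewrite /P; nat_mx_compute; ring.
apply: (block_equiv_left PP); apply: direct; last 1 first.
- have -> : P *m B *m J 2 *m (P *m B)^T = P *m (B *m J 2 *m B^T) *m P^T.
    by rewrite trmx_mul !mulmxA.
  by rewrite gB /P; nat_mx_compute; ring.
- by rewrite row_free_unit unitmx_mul -[B \in _]row_free_unit fB orthogonal_unit.
- by rewrite oppr_eq0.
Qed.

Lemma row_free_B4 : row_free B4^T.
Proof.
apply: (@row_free_mul1 _ _ _ (mx_of 3 2 [:: [:: 1; 0]; [:: 0; 1]; [:: 0; 0]])).
by nat_mx_compute.
Qed.

Lemma row_free_B6 : row_free B6^T.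
Proof.
apply: (@row_free_mul1 _ _ _ (mx_of 4 2 [:: [:: 1; 0]; [:: 0; 0]; [:: 0; 1]; [:: 0; 0]])).
by nat_mx_compute.
Qed.

Lemma row_free_B5 : row_free B5.
Proof.
apply: (@row_free_mul1 _ _ _
  (mx_of 4 3 [:: [:: 1; 0; 0]; [:: 0; 1; 0]; [:: 0; 0; 0]; [:: 0; 0; - ii]])).
by nat_mx_compute; ring: ii2.
Qed.

Lemma block_equiv_4_2 (B : 'M[C]_(4, 2)) :
  \rank B = 2%N -> B^T *m B = 0 -> block_equiv B B6.
Proof.
move=> rB BB; have fB : row_free B^T by rewrite /row_free mxrank_tr rB.
have [|P [PP <-]] := column_witt fB row_free_B6.
  by rewrite BB; nat_mx_compute; ring: ii2.
by apply: block_equiv_left PP (block_equiv_refl _).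
Qed.

(** The kernel vector [v] is isotropic, so it lies in the column space and makes [B^T *m B]
    singular, of rank 1. A symplectic change brings this Gram matrix to [diag(1, 0)], that of the
    columns of [B4]. *)
Lemma block_equiv_3_2 (B : 'M[C]_(3, 2)) :
  irreducible (canon B) -> \rank B = 2%N -> block_equiv B B4.
Proof.
move=> irrB rB.
have symM : (B^T *m B)^T = B^T *m B by rewrite trmx_mul trmxK.
have [v v0 vB] : exists2 v : 'rV[C]_3, v != 0 & v *m B = 0.
  have : kermx B != 0 by rewrite -mxrank_eq0 mxrank_ker rB.
  by case/rowV0Pn => v /sub_kermxP vB v0; exists v.
have vv := irreducible_left_kernel irrB isT vB.
have /submxP[z vz] : (v <= B^T)%MS.
  apply: (@submx_max_kernel _ 1 _ _ _ v^T) => //.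
    by rewrite -trmx_mul vB trmx0.
  by rewrite !mxrank_tr rB rank_rV v0.
have rM : \rank (B^T *m B) = 1%N.
  apply/eqP; rewrite eqn_leq lt0n mxrank_eq0; apply/andP; split; last first.
    by apply/eqP => /mulmx0_rank_max; rewrite mxrank_tr rB.
  rewrite -ltnS ltn_neqAle rank_leq_row andbT; apply/negP => fM.
  have z0 : z = 0 by apply: (row_free_inj0 fM); rewrite mulmxA -vz.
  by rewrite vz z0 mul0mx eqxx in v0.
have [w Mw] := sym_rank1 symM rM.
have w0 : w != 0.
  by apply: contra_eq_neq rM => w0; rewrite Mw w0 mulmx0 mxrank0.
have [Q [QJ wQ]] := symplectic_row (m := 2) isT w0 row10_neq0.
have uQ : Q \in unitmx by apply: symplectic_unit QJ.
apply: block_equiv_right QJ _.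
have fBQ : row_free (B *m Q^T)^T.
  by rewrite /row_free mxrank_tr mxrankMfree ?row_free_unit ?unitmx_tr ?rB.
have [|P [PP <-]] := column_witt fBQ row_free_B4.
  rewrite trmx_mul trmxK mulmxA -[Q *m _ *m _]mulmxA Mw.
  rewrite mulmxA -mulmxA wQ -[Q *m w^T]trmxK trmx_mul trmxK wQ.
  by nat_mx_compute; ring: ii2.
by apply: block_equiv_left PP (block_equiv_refl _).
Qed.

(** The hypothesis says that [K] kills [kappa] and sends the second basis vector to [kappa]: the
    former gives a multiple of [K5], the latter fixes the factor. *)
Lemma skew3_kappa2 (K : 'M[C]_3) :
  K^T = - K -> kappa2 1 *m K = mx_of 2 2 [:: [:: 0; 0]; [:: 1; 0]] *m kappa2 1 -> K = K5.
Proof.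
move=> skK e; have kK : kappa *m K = 0.
  have -> : kappa = mx_of 1 2 [:: [:: 1; 0]] *m kappa2 1 by nat_mx_compute; ring.
  by rewrite -mulmxA e; nat_mx_compute; ring.
have [p Kp] := skew3_kappa skK kK; move: e; rewrite Kp.
rewrite [kappa2 1]mx_ofE [K5]mx_ofE [mx_of 2 2 _]mx_ofE nat_mxZ !nat_mxM.
move/matrixP/(_ 1 0); rewrite !mxE /nat_dot /=.
rewrite ?(mulr0,mul0r,addr0,add0r,mulr1,mul1r) mulrN1 => /oppr_inj ->.
by rewrite -nat_mxZ scale1r.
Qed.

Lemma row_free_kappa2 a : a != 0 -> row_free (kappa2 a).
Proof.
move=> a0; apply: (@row_free_mul1 _ _ _ (mx_of 3 2 [:: [:: - a^-1; 0]; [:: 0; 1]; [:: 0; 0]])).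
by nat_mx_compute; rewrite mulrNN mulfV.
Qed.

(* Here [B J B^T] has an isotropic radical line: aligning it with [kappa]
   determines [B J B^T] up to a factor,
   which a hyperbolic rotation fixing the second basis vector removes. *)
Lemma block_equiv_3_4 (B : 'M[C]_(3, 4)) :
  irreducible (canon B) -> \rank B = 3%N -> block_equiv B B5.
Proof.
move=> irrB rB; have fB : row_free B by rewrite /row_free rB.
have uJ : J 4 \in unitmx by apply: Jmx_unit.
have [K KE] : exists K, K = B *m J 4 *m B^T by eexists.
have skK : K^T = - K by rewrite KE tr_gram.
have K0 : K != 0.
  rewrite KE; apply/eqP => /mulmx0_rank_max.
  by rewrite mxrankMfree ?row_free_unit // mxrank_tr rB.
(* A skew matrix of odd size is singular. *)
have [u u0 uK] : exists2 u : 'rV[C]_3, u != 0 & u *m K = 0.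
  have : kermx K != 0.
    rewrite kermx_eq0 row_free_unit; apply/negP => uK.
    by have := skew_unit_even skK uK.
  by case/rowV0Pn => u /sub_kermxP uK u0; exists u.
have [T BT] := row_freeP fB.
(* [B] has full row rank, so its column space contains every vector, in particular the radical
   vector [u]. *)
have uu : u *m u^T = 0.
  apply: (irreducible_column_space irrB (b := (T *m u^T)^T)) => //.
    by rewrite trmxK mulmxA BT mul1mx.
  by move: uK; rewrite KE !mulmxA.
have kappa0 : kappa != 0.
  by apply/matrix0Pn; exists 0, 0; rewrite mxE /= oppr_eq0 oner_neq0.
have [||| P [PP uP]] := @orthogonal_witt 1 3 u kappa.
- by rewrite /row_free rank_rV u0.
- by rewrite /row_free rank_rV kappa0.
- by rewrite uu kappa_isotropic.
have PtP : P^T *m P^T^T = 1%:M by rewrite trmxK orthogonal_tr.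
apply: (block_equiv_left PtP).
have gram_mul (P0 : 'M[C]_3) X :
    P0 *m X *m J 4 *m (P0 *m X)^T = P0 *m (X *m J 4 *m X^T) *m P0^T.
  by rewrite trmx_mul !mulmxA.
have kK2 : kappa *m (P^T *m K *m P^T^T) = 0.
  by rewrite -uP trmxK !mulmxA -[u *m P *m _]mulmxA PP mulmx1 uK mul0mx.
have [|p K2] := skew3_kappa _ kK2; first by rewrite KE -gram_mul tr_gram.
have p0 : p != 0.
  apply: contraNneq K0 => p0; move: K2; rewrite p0 scale0r.
  move/(congr1 (fun X => P *m X *m P^T)); rewrite mulmx0 mul0mx trmxK !mulmxA.
  by rewrite PP mul1mx -mulmxA PP mulmx1 => ->.
(* [P'] sends [p] times [kappa] to [kappa] and fixes the second basis vector; the Gram matrices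
   agree because [kappa] is isotropic. *)
have [|P' [PP' kP']] := orthogonal_witt (row_free_kappa2 p0) (row_free_kappa2 (oner_neq0 _)).
  by nat_mx_compute; ring: ii2.
have PtP' : P'^T *m P'^T^T = 1%:M by rewrite trmxK orthogonal_tr.
apply: (block_equiv_left PtP').
set B' := P'^T *m (P^T *m B).
have gB' : B' *m J 4 *m B'^T = K5.
  apply: skew3_kappa2; first exact: tr_gram.
  rewrite gram_mul gram_mul -KE K2 trmxK mulmxA mulmxA -{1}kP'.
  rewrite -[kappa2 p *m P' *m _]mulmxA PP' mulmx1 -kP' [RHS]mulmxA; congr (_ *m _).
  by nat_mx_compute; ring: ii2.
have fB' : row_free B'.
  have full (X : 'M[C]_3) : X *m X^T = 1%:M -> row_full X.
    by move=> XX; rewrite row_full_unit orthogonal_unit.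
  by rewrite /row_free !(eqmxMfull _ (full _ _)).
have [//||Q [QJ <-]] := symplectic_witt _ fB' row_free_B5; first by rewrite gB' B5_gram.
by apply: block_equiv_right QJ (block_equiv_refl _).
Qed.

(** * Possible dimensions and the classification of blocks *)

(** A finite check; the last hypothesis discards exactly the triples [(2, 4, 2)] and [(3, 4, 2)]. *)
Lemma irreducible_dims (k m r : nat) :
  (k + m <= 7)%N -> ~~ odd m -> (0 < r)%N -> (r <= k)%N -> (r <= m)%N ->
  (k <= 2 * r)%N -> (m <= 2 * r)%N -> ((1 < k)%N -> m = (2 * r)%N -> (m <= k)%N) ->
  (k = 1 /\ m = 2 /\ r = 1 \/ k = 2 /\ m = 2 /\ r = 1 \/
   k = 2 /\ m = 2 /\ r = 2 \/ k = 3 /\ m = 2 /\ r = 2 \/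
   k = 4 /\ m = 2 /\ r = 2 \/ k = 3 /\ m = 4 /\ r = 3)%N.
Proof.
case: k => [|[|[|[|[|[|[|[|k]]]]]]]] //; case: m => [|[|[|[|[|[|[|[|m]]]]]]]] //;
  case: r => [|[|[|[|[|[|[|[|r]]]]]]]] // _ _ _ _ _ _ _ mk;
  try (by tauto); by have := mk isT erefl.
Qed.

Lemma classify_block k m (B : 'M[C]_(k, m)) :
  (k + m <= 7)%N -> ~~ odd m -> B != 0 -> irreducible (canon B) ->
  exists B' : 'M[C]_(k, m), listed B' /\ block_equiv B B'.
Proof.
move=> km om B0 irrB.
have r0 : (0 < \rank B)%N by rewrite lt0n mxrank_eq0.
have rk := rank_leq_row B; have rm := rank_leq_col B.
have k0 : (0 < k)%N by lia.
have m0 : (0 < m)%N by lia.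
have kr := dim_left_le irrB m0; have mr := dim_right_le irrB om k0.
have mk := dim_right_le_left irrB om.
have gram0 := left_gram0 irrB m0.
case: (irreducible_dims km om r0 rk rm kr mr mk) =>
  [[ek [em rB]]|[[ek [em rB]]|[[ek [em rB]]|[[ek [em rB]]|[[ek [em rB]]|[ek [em rB]]]]]]];
  subst k m.
- exists B1; split; first by left.
  exact: block_equiv_1_2.
- exists B3; split; first by right; right; left.
  by apply: block_equiv_2_2_rank1 => //; apply: gram0; rewrite rB.
- have [a aP eB] := block_equiv_2_2_rank2 rB.
  by exists (B2 a); split=> //; right; left; split=> //; exists a.
- exists B4; split; first by do 3 right; left.
  exact: block_equiv_3_2.
- exists B6; split; first by do 5 right.
  by apply: block_equiv_4_2 => //; apply: gram0; rewrite rB.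
- exists B5; split; first by do 4 right; left.
  exact: block_equiv_3_4.
Qed.

Lemma sequiv_canon_neq0 k m (G : 'M[C]_(k + m)) (B : 'M[C]_(k, m)) :
  ursubmx G != 0 -> sequiv G (canon B) -> B != 0.
Proof.
move=> G0 [P [Q [uP uQ]]]; rewrite -[G]submxK sspace_mul => /eq_block_mx[_ -> _ _].
apply: contraNneq G0 => PGQ.
have /(congr1 (fun X => invmx P *m X *m invmx Q^T)) := PGQ.
by rewrite !mulmxA mulVmx // mul1mx mulmxK ?unitmx_tr // mulmx0 mul0mx => ->.
Qed.

(** * Irreducibility of the listed forms *)

Lemma idempotent_compl n (E : 'M[C]_n) :
  E *m E = E -> (1%:M - E) *m (1%:M - E) = 1%:M - E.
Proof. by move=> EE; rewrite mulmxBl mul1mx mulmxBr mulmx1 EE subrr subr0. Qed.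

(* Complementary pairs of idempotents describe the same decomposition, so one
   may choose which of the two summands to show to be zero. *)
Lemma irreducible_canon k m (B : 'M[C]_(k, m)) :
  (forall (E0 : 'M[C]_k) (E1 : 'M[C]_m),
     E0 *m E0 = E0 -> E1 *m E1 = E1 -> E0^T = E0 -> E1 *m J m = J m *m E1^T ->
     E0 *m B = B *m E1^T ->
     (E0 = 0 /\ E1 = 0) \/ (1%:M - E0 = 0 /\ 1%:M - E1 = 0)) ->
  irreducible (canon B).
Proof.
move=> triv /canon_reducibleP[E0 [E1 [[E00 E11 symE EJ] n0 n1 EB]]].
have [[e0 e1]|[/subr0_eq e0 /subr0_eq e1]] := triv _ _ E00 E11 symE EJ EB.
  by move: n0; rewrite e0 e1 !eqxx.
by move: n1; rewrite -e0 -e1 !eqxx.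
Qed.

(** [B *m T] is the identity plus a skew matrix. Multiplying its symmetrization by [E] on both sides
    gives [2 E] on one hand and 0 on the other. *)
Lemma left_idempotent_eq0 k m (B : 'M[C]_(k, m)) (E : 'M[C]_k) T :
  B *m T + (B *m T)^T = 2%:M -> E *m E = E -> E^T = E -> E *m B = 0 -> E = 0.
Proof.
move=> BT EE symE EB; have : E *m (B *m T + (B *m T)^T) *m E = 0.
  rewrite mulmxDr mulmxDl mulmxA EB !mul0mx add0r -mulmxA -{2}symE -trmx_mul.
  by rewrite mulmxA EB mul0mx trmx0 mulmx0.
rewrite BT mul_mx_scalar -scalemxAl EE => /eqP.
by rewrite scaler_eq0 pnatr_eq0 /= => /eqP.
Qed.

(** The condition makes [E *m J 2] skew, hence a multiple of [J 2]. *)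
Lemma scalar_Jmx2 (E : 'M[C]_2) :
  E *m J 2 = J 2 *m E^T -> exists a, E = a%:M.
Proof.
move=> EJ; have natE : E = nat_mx 2 2 (fun i j => E (inord i) (inord j)).
  by apply/matrixP => i j; rewrite mxE !inord_val.
move: natE EJ; move: (fun i j => E (inord i) (inord j)) => f -> {E}.
rewrite Jmx_natE nat_mxT !nat_mxM => /matrixP e.
have := e 0 0; have := e 1 1; have := e 0 1.
rewrite !mxE /nat_dot /= ?(mulr0,mul0r,addr0,add0r,mulr1,mul1r,mulrN1,mulN1r).
rewrite modn_small // => f11 f10 f01; exists (f 0%N 0%N).
have eq_opp0 (x : C) : x = - x -> x = 0.
  by move/eqP; rewrite -addr_eq0 -mulr2n mulrn_eq0 => /eqP.
apply/matrixP => i j; rewrite !mxE.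
case: i => [[|[|//]] hi]; case: j => [[|[|//]] hj] //=.
- by rewrite (eq_opp0 _ (esym f01)).
- by rewrite (eq_opp0 _ f10).
Qed.

(** [E1] is a scalar idempotent, so 0 or 1; accordingly [E0] or its complement annihilates [B] and
    vanishes. *)
Lemma irreducible_2 k (B : 'M[C]_(k, 2)) T :
  B *m T + (B *m T)^T = 2%:M -> irreducible (canon B).
Proof.
move=> BT; apply: irreducible_canon => E0 E1 E00 E11 symE EJ EB.
have [a Ea] := scalar_Jmx2 EJ.
have left0 E : E *m E = E -> E^T = E -> E *m B = 0 -> E = 0.
  exact: left_idempotent_eq0 BT.
have : a * a = a.
  by move/matrixP/(_ 0 0): E11; rewrite Ea -scalar_mxM !mxE /= !mulr1n.
move/eqP; rewrite -subr_eq0 -{3}[a]mulr1 -mulrBr mulf_eq0 subr_eq0.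
case/orP=> /eqP a0; move: Ea; rewrite a0 ?raddf0 => Ea; [left|right]; split=> //.
- by apply: left0; rewrite // EB Ea trmx0 mulmx0.
- apply: left0; rewrite ?idempotent_compl // ?mulmxBl ?mul1mx ?EB ?Ea ?trmx1 ?mulmx1 ?subrr //.
  by rewrite linearB /= trmx1 symE.
- by rewrite Ea subrr.
Qed.

(** The identity [X *m Y + c *m v = 1%:M] certifies that the left kernel of [X] lies in the row
    space of [v]. *)
Lemma kernel_factor n p q s (X : 'M[C]_(n, p)) (Y : 'M[C]_(p, n)) (c : 'M[C]_(n, q))
    (v : 'M[C]_(q, n)) (E : 'M[C]_(s, n)) :
  X *m Y + c *m v = 1%:M -> E *m X = 0 -> E = E *m c *m v.
Proof.
move=> XY EX; rewrite -{1}[E]mulmx1 -XY mulmxDr mulmxA EX mul0mx add0r.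
exact: mulmxA.
Qed.

Lemma irreducible_B5 : irreducible (canon B5).
Proof.
apply: irreducible_canon => E0 E1.
pose s1 : 'M[C]_(3, 1) := mx_of 3 1 [:: [:: -1]; [:: 0]; [:: 0]].
pose T1 : 'M[C]_3 := mx_of 3 3 [:: [:: 0; -1; 0]; [:: 0; 0; ii]; [:: 0; 0; 0]].
have KT : K5 *m T1 + s1 *m kappa = 1%:M.
  by rewrite /T1 /s1; nat_mx_compute; ring: ii2.
(* [rho] spans the left kernel of [B5^T]; [s2] and [T2] certify this, as [s1] and [T1] do for
   [kappa] and [K5]. *)
pose rho : 'M[C]_(1, 4) := mx_of 1 4 [:: [:: 0; 1; -1; 0]].
pose s2 : 'M[C]_(4, 1) := mx_of 4 1 [:: [:: 0]; [:: 0]; [:: -1]; [:: 0]].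
pose T2 : 'M[C]_(3, 4) :=
  mx_of 3 4 [:: [:: 1; 0; 0; 0]; [:: 0; 1; 0; 0]; [:: 0; 0; 0; - ii]].
have BT : B5^T *m T2 + s2 *m rho = 1%:M.
  by rewrite /T2 /s2 /rho; nat_mx_compute; ring: ii2.
have KK : K5 *m K5 = -1 *: (kappa^T *m kappa).
  by nat_mx_compute; ring: ii2.
(* The idempotent [E0] commutes with the nilpotent [K5], whose kernel is the
   line of [kappa]; if it kills [kappa] it vanishes. *)
have left0 (E : 'M[C]_3) : E *m E = E -> E^T = E -> E *m K5 = K5 *m E ->
    kappa *m E = 0 -> E = 0.
  move=> EE symE EK kE.
  have Ek : E *m kappa^T = 0 by rewrite -symE -trmx_mul kE trmx0.
  have EK0 : E *m K5 = 0.
    have EKK : E *m K5 *m K5 = 0 by rewrite -mulmxA KK -scalemxAr mulmxA Ek mul0mx scaler0.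
    have := kernel_factor KT EKK => EKk.
    by rewrite -EE -mulmxA EK mulmxA EKk -mulmxA kE mulmx0.
  by rewrite -EE {1}(kernel_factor KT EK0) -mulmxA kE mulmx0.
have right0 (E : 'M[C]_4) : E *m E = E -> E *m J 4 = J 4 *m E^T ->
    B5 *m E^T = 0 -> E = 0.
  move=> EE EJ BE; have EB : E *m B5^T = 0.
    by apply: trmx_inj; rewrite trmx_mul trmxK BE trmx0.
  (* The rows of [E] are multiples of [rho], so [E *m J 4 *m E^T], which equals [E *m J 4], vanishes
     because [rho] is isotropic. *)
  have EJ0 : E *m J 4 = 0.
    rewrite -EE -mulmxA EJ mulmxA (kernel_factor BT EB).
    rewrite !trmx_mul -!mulmxA [rho *m _]mulmxA [rho *m J 4 *m _]mulmxA.
    by rewrite alternating_self ?tr_Jmx // mul0mx !mulmx0.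
  by apply: (row_free_inj0 _ EJ0); rewrite row_free_unit Jmx_unit.
move=> E00 E11 symE EJ EB.
have EJ' : E1^T *m J 4 = J 4 *m E1.
  have : J 4 *m (E1 *m J 4) *m J 4 = J 4 *m (J 4 *m E1^T) *m J 4 by rewrite EJ.
  rewrite !mulmxA -[LHS]mulmxA !mul_Jmx // mulmxN mulmx1 !mulNmx mul1mx.
  by move/oppr_inj.
have EK : E0 *m K5 = K5 *m E0.
  rewrite -B5_gram !mulmxA EB -[B5 *m _ *m J 4]mulmxA EJ' -!mulmxA.
  by rewrite -[E1]trmxK -trmx_mul -EB trmx_mul symE.
(* Since [E0] commutes with [K5], it preserves the kernel line and acts there by a scalar [l], which
   is 0 or 1. *)
have kE0 : kappa *m E0 = (kappa *m E0 *m s1) *m kappa.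
  by apply: kernel_factor KT _; rewrite -mulmxA EK mulmxA kappa_K5 mul0mx.
have [l lE] : exists l, kappa *m E0 *m s1 = l%:M by eexists; exact: mx11_scalar.
have {lE} kE : kappa *m E0 = l *: kappa by rewrite kE0 lE mul_scalar_mx.
have : l * l = l.
  have : kappa *m (E0 *m E0) = kappa *m E0 by rewrite E00.
  rewrite mulmxA kE -scalemxAl kE => /matrixP/(_ 0 0); rewrite !mxE /= !mulrN1.
  by rewrite mulrN => /oppr_inj.
have symE' : (1%:M - E0)^T = 1%:M - E0 by rewrite linearB /= trmx1 symE.
move/eqP; rewrite -subr_eq0 -{3}[l]mulr1 -mulrBr mulf_eq0 subr_eq0.
case/orP=> /eqP l0; [left|right]; move: kE; rewrite l0 ?scale0r ?scale1r => kE.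
  have E0z : E0 = 0 by apply: left0.
  by split=> //; apply: right0; rewrite // -EB E0z mul0mx.
have E0z : 1%:M - E0 = 0.
  apply: left0; rewrite ?idempotent_compl //.
    by rewrite mulmxBl mulmxBr mul1mx mulmx1 EK.
  by rewrite mulmxBr mulmx1 kE subrr.
split=> //; apply: right0; first exact: idempotent_compl.
  by rewrite linearB /= trmx1 mulmxBl mulmxBr mul1mx mulmx1 EJ.
by rewrite [(_ - _)^T]linearB /= trmx1 mulmxBr mulmx1 -EB -{1}[B5]mul1mx -mulmxBl E0z mul0mx.
Qed.

Lemma admissible_canon k m (B : 'M[C]_(k, m)) :
  ~~ odd m -> (0 < k)%N -> B != 0 -> irreducible (canon B) -> admissible (canon B).
Proof.
move=> om k0 B0 irrB; rewrite /admissible /supersym /inhomogeneous /nondeg_restrictions.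
rewrite /canon block_mxKul block_mxKur block_mxKdl block_mxKdr trmx1 tr_Jmx.
split=> //; first by split=> //; left; exact: one_mx_neq0.
by rewrite det1 oner_neq0 -unitfE -unitmxE Jmx_unit.
Qed.

Lemma listed_admissible k m (B : 'M[C]_(k, m)) : listed B -> admissible (canon B).
Proof.
have nz k' m' (s : seq (seq C)) : nth 0 (nth [::] s 0) 0 = 1 ->
    mx_of k'.+1 m'.+1 s != 0.
  by move=> s1; apply/matrix0Pn; exists 0, 0; rewrite mxE s1 oner_neq0.
case=> [[ek em ->]|[[ek em [a aP ->]]|[[ek em ->]|[[ek em ->]|[[ek em ->]|[ek em ->]]]]]];
  subst k m; apply: admissible_canon => //; try exact: nz; last 2 first.
- exact: irreducible_B5.
(* In this and the following cases the given matrix multiplies the block to the identity plus a skew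
   matrix. *)
- apply: (@irreducible_2 _ _ (mx_of 2 4 [:: [:: 1; - ii; 0; 0]; [:: 0; 0; 1; - ii]])).
  by rewrite -scalemx1; nat_mx_compute; ring: ii2.
- apply: (@irreducible_2 _ _ (mx_of 2 1 [:: [:: 1]; [:: 0]])).
  by rewrite -scalemx1; nat_mx_compute; ring.
- apply: (@irreducible_2 _ _ (mx_of 2 2 [:: [:: 1; 0]; [:: 0; a^-1]])).
  by rewrite -scalemx1; nat_mx_compute; rewrite ?mulfV ?Cplus_neq0 //; ring.
- apply: (@irreducible_2 _ _ (mx_of 2 2 [:: [:: 1; - ii]; [:: 0; 0]])).
  by rewrite -scalemx1; nat_mx_compute; ring: ii2.
- apply: (@irreducible_2 _ _ (mx_of 2 3 [:: [:: 1; 0; 0]; [:: 0; 1; - ii]])).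
  by rewrite -scalemx1; nat_mx_compute; ring: ii2.
Qed.

(** * Inequivalence of the listed forms *)

(** Orthogonal and symplectic matrices have determinants of square 1. *)
Lemma block_equiv_det n (B B' : 'M[C]_n) :
  ~~ odd n -> block_equiv B B' -> (\det B') ^+ 2 = (\det B) ^+ 2.
Proof.
move=> on [P [Q [PP QJ ->]]].
have detP : \det P * \det P = 1 by rewrite -{2}det_tr -det_mulmx PP det1.
have detQ : \det Q * \det Q = 1.
  have J0 : \det (J n) != 0 by rewrite -unitfE -unitmxE Jmx_unit.
  apply: (mulfI J0); rewrite mulr1 -{2}QJ !det_mulmx det_tr; ring.
rewrite !det_mulmx det_tr.
transitivity (\det P * \det P * (\det Q * \det Q) * \det B ^+ 2); first by ring.
by rewrite detP detQ !mul1r.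
Qed.

Lemma det_lower2 (a b d : C) : \det (mx_of 2 2 [:: [:: a; 0]; [:: b; d]]) = a * d.
Proof.
rewrite det_trig; last first.
  by apply/is_trig_mxP => i j; rewrite mxE; case: i => [[|[|//]] ?]; case: j => [[|[|//]] ?].
by rewrite !big_ord_recl big_ord0 !mxE /= mulr1.
Qed.

(** Only the dimensions [(2, 2)] carry several entries. There the squared determinant is [a ^+ 2]
    for [B2 a] and 0 for [B3], and [Cplus] excludes opposite parameters. *)
Lemma listed_equiv_eq k m (B B' : 'M[C]_(k, m)) :
  listed B -> listed B' -> block_equiv B B' -> B = B'.
Proof.
case=> [[ek em ->]|[[ek em [a aP ->]]|[[ek em ->]|[[ek em ->]|[[ek em ->]|[ek em ->]]]]]];
  subst k m;
case=> [[ek em ->]|[[ek em [b bP ->]]|[[ek em ->]|[[ek em ->]|[[ek em ->]|[ek em ->]]]]]] //;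
  move/block_equiv_det=> /(_ isT); rewrite !det_lower2 !mul1r ?expr0n /=.
- move/eqP; rewrite eqf_sqr => /orP[/eqP -> //|/eqP ba].
  by case: (Cplus_opp aP); rewrite -ba.
- by move/esym/eqP; rewrite sqrf_eq0 (negPf (Cplus_neq0 aP)).
- by move/eqP; rewrite sqrf_eq0 (negPf (Cplus_neq0 bP)).
Qed.

End Blocks.

Theorem theorem3p2 (R : realType) :
  (* classification *)
  (forall (k m : nat) (G : 'M[R[i]]_(k + m)),
      (k + m <= 7)%N -> admissible G ->
      exists B : 'M[R[i]]_(k, m), listed B /\ sequiv G (canon B)) /\
  (* each listed form has the required properties *)
  (forall (k m : nat) (B : 'M[R[i]]_(k, m)), listed B -> admissible (canon B)) /\
  (* distinct entries give inequivalent forms *)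
  (forall (k m : nat) (B B' : 'M[R[i]]_(k, m)),
      listed B -> listed B' -> sequiv (canon B) (canon B') -> B = B').
Proof.
split; last first.
  split; first exact: listed_admissible.
  by move=> k m B B' lB lB' /sequiv_canon; apply: listed_equiv_eq.
move=> k m G km [symG [G0 _] irrG ndG].
have [om [B GB]] := canonical_block symG ndG.
have irrB : irreducible (canon B) by move/(sequiv_reducible GB).
have [B' [lB' BB']] := classify_block km om (sequiv_canon_neq0 G0 GB) irrB.
exists B'; split=> //.
exact: sequiv_trans GB (block_equiv_sequiv om BB').
Qed.
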